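(* Let $0<Q<n$, let $E\subset\mathbb{R}^n$ be a compact Ahlfors $Q$-regular set with $\operatorname{diam}(E)\le 1$, let $B\subset\mathbb{R}^n$ be a ball with $E\subset\tfrac12 B$, and let $\nu=\mathcal{H}^Q|_E$. Let $p>1$ and $0<\theta<1$ be such that $p\theta<1$. Let $\alpha\le 0$ be such that $\alpha+n-Q>0$ and $\theta<1-\tfrac{\alpha+n-Q}{p}$, and let $\mu_\alpha$ be a measure on $\mathbb{R}^n$, absolutely continuous with respect to Lebesgue measure, with $\mu_\alpha(B(x,r))\simeq r^{n+\alpha}$ for all $x\in E$ and $0<r\le 10$, such that $\mu_\alpha$ is doubling on $B$ and supports a $p$-Poincaré inequality on $B$. Then there is a bounded linear trace operator \[ T:N^{1,p}(B,\mu_\alpha)\to B^\theta_{p,p}(E,\nu) \] such that $Tu=u|_E$ whenever $u$ is a Lipschitz function on $B$.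
   Context: Notation: $m$ is Lebesgue measure on $\mathbb{R}^n$, $d$ the Euclidean metric, $\mathcal{H}^Q$ the $Q$-dimensional Hausdorff measure, $\tau B$ the ball concentric with $B$ with radius $\tau$ times as large, $\operatorname{rad}(B_0)$ the radius of a ball $B_0$. $F\simeq G$ means $C^{-1}G\le F\le CG$ with a constant $C\ge1$ independent of the points and radii involved. $E$ is Ahlfors $Q$-regular if $\mathcal{H}^Q(E\cap B(x,r))\simeq r^Q$ for all $x\in E$ and $0<r\le\operatorname{diam}(E)$. The measure $\mu_\alpha$ is a Borel regular measure of the form $d\mu_\alpha=\omega\,dm$ with $\omega\ge 0$ locally integrable. Weighted Sobolev space: $N^{1,p}(B,\mu_\alpha)=W^{1,p}(B,\mu_\alpha)$ consists of the functions $f\in L^p(B,\mu_\alpha)$ having a weak derivative $\nabla f:B\to\mathbb{R}^n$ with $|\nabla f|\in L^p(B,\mu_\alpha)$, with norm $\|f\|_{N^{1,p}(B,\mu_\alpha)}=\|f\|_{L^p(B,\mu_\alpha)}+\||\nabla f|\|_{L^p(B,\mu_\alpha)}$. Doubling on $B$: there is $C\ge1$ with $\mu_\alpha(B(x,2r))\le C\mu_\alpha(B(x,r))$ for all $x\in B$, $0<r\le 10$. $p$-Poincaré inequality on $B$: there is $C>1$ such that for all $f\in W^{1,p}(B,\mu_\alpha)$ and all balls $B_0$ with $B_0\cap B\neq\emptyset$ and $\operatorname{rad}(B_0)\le 10$, \[ \frac1{\mu_\alpha(B_0)}\int_{B_0}|f-f_{B_0}|\,d\mu_\alpha\le C\operatorname{rad}(B_0)\Big(\frac1{\mu_\alpha(B_0)}\int_{B_0}|\nabla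 f|^p\,d\mu_\alpha\Big)^{1/p},\qquad f_{B_0}=\frac1{\mu_\alpha(B_0)}\int_{B_0}f\,d\mu_\alpha. \] In these two conditions the underlying space is $B$ with the Euclidean metric and the measure $\mu_\alpha$, so balls are understood as intersected with $B$. Besov space: $B^\theta_{p,p}(E,\nu)$ consists of the $u\in L^p(E,\nu)$ with \[ \|u\|_{B^\theta_{p,p}(E,\nu)}^p=\int_E\int_E\frac{|u(y)-u(x)|^p}{d(x,y)^{\theta p}\,\nu(B(x,d(x,y)))}\,d\nu(y)\,d\nu(x)<\infty . \] Boundedness of $T$ is with respect to $\|u\|_{L^p(E,\nu)}+\|u\|_{B^\theta_{p,p}(E,\nu)}$ on the target. *)

(* Defs.v *)
From HB Require Import structures.
From mathcomp Require Import all_boot all_order all_algebra.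
From mathcomp Require Import all_classical all_reals all_analysis.
From mathcomp Require Import measurable_realfun.
Set Implicit Arguments.
Unset Strict Implicit.
Unset Printing Implicit Defensive.
Import Order.TTheory GRing.Theory Num.Theory.
Import numFieldNormedType.Exports.
Local Open Scope classical_set_scope.
Local Open Scope ring_scope.

Definition rV_display : measure_display -> measure_display.
Proof. exact. Qed.

(* The measurable sets are generated by the coordinate functions, as in the
   library's structure on [n.-tuple]; by [rV_measurableE] these are exactly the
   Borel sets. *)
Section rV_measurable.
Context {R : realType} (n : nat).

Let coord (i : 'I_n) (v : 'rV[R]_n) : R := v ord0 i.

Let rV_set0 : g_sigma_preimage coord set0.
Proof. exact: sigma_algebra0. Qed.

Let rV_setC A : g_sigma_preimage coord A -> g_sigma_preimage coord (~` A).
Proof. exact: sigma_algebraC. Qed.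

Let rV_bigcup (F : _^nat) : (forall i, g_sigma_preimage coord (F i)) ->
  g_sigma_preimage coord (\bigcup_i (F i)).
Proof. exact: sigma_algebra_bigcup. Qed.

HB.instance Definition _ :=
  @isMeasurable.Build (rV_display default_measure_display)
    'rV[R]_n (g_sigma_preimage coord) rV_set0 rV_setC rV_bigcup.

Lemma measurable_rV_coord (i : 'I_n) :
  measurable_fun [set: 'rV[R]_n] (fun v : 'rV[R]_n => v ord0 i).
Proof.
move=> _ Y mY; rewrite setTI; apply: sub_sigma_algebra => /=.
rewrite -bigcup_seq/=; exists i => /=; first by rewrite mem_index_enum.
by exists Y => //; rewrite setTI.
Qed.

Lemma rV_measurable_sub (G : set (set 'rV[R]_n)) :
  sigma_algebra setT G ->
  (forall i (Y : set R), measurable Y -> G [set v | Y (v ord0 i)]) ->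
  (measurable : set (set 'rV[R]_n)) `<=` G.
Proof.
move=> sG hG; apply: smallest_sub => //.
rewrite -bigcup_seq/=; apply: bigcup_sub => i _ A [Y mY <-].
by rewrite setTI; exact: hG.
Qed.

Lemma measurable_fun_rV d (T : measurableType d) (f : T -> 'rV[R]_n) :
  (forall i, measurable_fun setT (fun x => f x ord0 i)) ->
  measurable_fun setT f.
Proof.
move=> mf _ A mA.
have : [set B | measurable (f @^-1` B)] A.
  move: A mA; apply: rV_measurable_sub.
    split; rewrite /=.
    - by rewrite preimage_set0.
    - by move=> B mB; rewrite setTD preimage_setC; exact: measurableC.
    - by move=> F mF; rewrite preimage_bigcup; exact: bigcupT_measurable.
  move=> i Y mY /=; have := mf i measurableT Y mY.
  by rewrite setTI.
by rewrite setTI.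
Qed.

End rV_measurable.

Section rV_borel.
Context {R : realType} (n : nat).

Lemma measurable_open_rV (U : set 'rV[R]_n) : open U -> measurable U.
Proof.
move=> oU.
pose W (p : 'rV[rat]_n * nat) : set 'rV[R]_n :=
  ball (map_mx ratr p.1 : 'rV[R]_n) p.2.+1%:R^-1.
pose V p := if `[< W p `<=` U >] then W p else set0.
have mW p : measurable (W p).
  rewrite (_ : W p = \bigcap_(i in [set: 'I_n])
    [set v : 'rV[R]_n | ball (ratr (p.1 ord0 i) : R) p.2.+1%:R^-1 (v ord0 i)]).
    apply: fin_bigcap_measurable => // i _.
    have := measurable_rV_coord i measurableT
      (open_measurable
        (@ball_open R R (ratr (p.1 ord0 i)) p.2.+1%:R^-1)).
    by rewrite setTI.
  apply/seteqP; split=> [v [_ pv] i _|v pv].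
    by have := pv ord0 i; rewrite mxE.
  split=> [|i j]; first by rewrite invr_gt0.
  by rewrite (ord1 i) mxE; exact: pv.
rewrite (_ : U = \bigcup_p V p); last first.
  apply/seteqP; split=> [x Ux|x [p _]]; last first.
    by rewrite /V; case: asboolP => // + Wx; apply.
  have /nbhs_ballP[e /= e0 xeU] : nbhs x U by apply: open_nbhs_nbhs.
  have [k ke] : exists k, k.+1%:R^-1 < e / 2 :> R.
    have e20 : 0 < e / 2 by rewrite divr_gt0.
    have [k _ /(_ k (leqnn k))] := near_infty_natSinv_lt (PosNum e20).
    by exists k.
  have k0 : 0 < k.+1%:R^-1 :> R by rewrite invr_gt0.
  have /choice[q xq] : forall i : 'I_n, exists q : rat,
      ball (ratr q : R) k.+1%:R^-1 (x ord0 i).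
    move=> i; have : x ord0 i < x ord0 i + k.+1%:R^-1 by rewrite ltrDl.
    move=> /rat_in_itvoo[q]; rewrite in_itv/= => /andP[xq qx].
    by exists q; rewrite /ball/= ger0_norm ?subr_ge0 ?ltW// ltrBlDl.
  pose p : 'rV[rat]_n * nat := (\row_i q i, k).
  have Wx : W p x by split=> // i j; rewrite !mxE (ord1 i); exact: xq.
  exists p => //; rewrite /V; case: asboolP => // WU; exfalso; apply: WU.
  apply: subset_trans xeU => y Wy.
  have H1 : ball x (e / 2) (map_mx ratr p.1 : 'rV[R]_n).
    by apply: ball_sym; apply: le_ball Wx; exact: ltW.
  have H2 : ball (map_mx ratr p.1 : 'rV[R]_n) (e / 2) y.
    by apply: le_ball Wy; exact: ltW.
  exact: ball_split H1 H2.
apply: countable_bigcupT_measurable => [|p].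
  exact: countableP.
by rewrite /V; case: ifPn.
Qed.

Lemma rV_measurableE :
  (measurable : set (set 'rV[R]_n)) = <<s (open : set (set 'rV[R]_n)) >>.
Proof.
apply/seteqP; split; last first.
  apply: smallest_sub; first exact: sigma_algebra_measurable.
  exact: measurable_open_rV.
apply: rV_measurable_sub; first exact: smallest_sigma_algebra.
move=> i Y mY.
have mf : @measurable_fun _ _
    (g_sigma_algebraType (open : set (set 'rV[R]_n))) R setT
    (fun v : 'rV[R]_n => v ord0 i).
  apply: (measurability _ (RGenOpens.measurableE R)) => _ [_ [a [b ->] <-]].
  rewrite setTI; apply: sub_sigma_algebra.
  apply: open_comp; last exact: itv_open.
  by move=> v _; exact: coord_continuous.
by have := mf measurableT Y mY; rewrite setTI.
Qed.

End rV_borel.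

Lemma compact_measurable_rV (R : realType) n (K : set 'rV[R]_n) :
  compact K -> measurable K.
Proof.
move=> cK; rewrite -[K]setCK; apply: measurableC; apply: measurable_open_rV.
by rewrite openC; apply: compact_closed cK; exact: norm_hausdorff.
Qed.

Lemma product_sigma_finite (R : realType) d1 (T1 : measurableType d1)
    d2 (T2 : measurableType d2)
    (m1 : {sigma_finite_measure set T1 -> \bar R})
    (m2 : {sigma_finite_measure set T2 -> \bar R}) :
  sigma_finite setT (m1 \x m2)%E.
Proof.
have /sigma_finiteP[F [TF ndF Foo]] := sigma_finiteT m1.
have /sigma_finiteP[G [TG ndG Goo]] := sigma_finiteT m2.
exists (fun n => F n `*` G n).
  rewrite -setXTT TF TG predeqE => -[x y]; split.
    move=> [/= [n _ Fnx] [k _ Gky]]; exists (maxn n k) => //; split.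
    - by move: x Fnx; exact/subsetPset/ndF/leq_maxl.
    - by move: y Gky; exact/subsetPset/ndG/leq_maxr.
  by move=> [n _ []/= ? ?]; split; exists n.
move=> k; have [? ?] := Foo k; have [? ?] := Goo k.
split; first exact: measurableX.
by rewrite product_measure1E// lte_mul_pinfty// ge0_fin_numE.
Qed.

Section lebesgue_rV.
Context {R : realType}.

Definition rV_cons n (xv : R * 'rV[R]_n) : 'rV[R]_n.+1 :=
  row_mx (xv.1%:M : 'rV_1) xv.2.

Let rV_uncons n (v : 'rV[R]_n.+1) : R * 'rV[R]_n :=
  (v ord0 ord0, \row_i v ord0 (lift ord0 i)).

Lemma rV_consE n (xv : R * 'rV[R]_n) :
  (rV_cons xv ord0 ord0 = xv.1) *
  (forall i : 'I_n, rV_cons xv ord0 (lift ord0 i) = xv.2 ord0 i).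
Proof.
split=> [|i].
  rewrite /rV_cons (_ : ord0 = lshift n (ord0 : 'I_1)); last exact: val_inj.
  by rewrite (row_mxEl (xv.1%:M : 'rV_1)) mxE eqxx mulr1n.
rewrite /rV_cons (_ : lift ord0 i = rshift 1 i); last exact: val_inj.
by rewrite (row_mxEr (xv.1%:M : 'rV_1)).
Qed.

Let rV_consK n : cancel (@rV_cons n) (@rV_uncons n).
Proof.
move=> [x v]; rewrite /rV_uncons !rV_consE; congr pair.
by apply/rowP => i; rewrite mxE rV_consE.
Qed.

Let measurable_rV_cons n : measurable_fun setT (@rV_cons n).
Proof.
apply: measurable_fun_rV => i; case: (unliftP ord0 i) => [j|] ->.
  rewrite (_ : (fun _ => _) = (fun v : 'rV[R]_n => v ord0 j) \o snd).
    by apply: measurableT_comp => //; exact: measurable_rV_coord.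
  by apply/funext => xv; rewrite rV_consE.
rewrite (_ : (fun _ => _) = fst) //.
by apply/funext => xv; rewrite rV_consE.
Qed.

Let measurable_rV_uncons n : measurable_fun setT (@rV_uncons n).
Proof.
apply/measurable_fun_pairP; split; first exact: measurable_rV_coord.
apply: measurable_fun_rV => i; rewrite (_ : (fun _ => _) =
  (fun v : 'rV[R]_n.+1 => v ord0 (lift ord0 i))); last first.
  by apply/funext => v; rewrite /= mxE.
exact: measurable_rV_coord.
Qed.

Section step.
Variables (n : nat) (m : {sigma_finite_measure set 'rV[R]_n -> \bar R}).
Local Open Scope ereal_scope.

Definition lebesgue_rV_step : set 'rV[R]_n.+1 -> \bar R :=
  pushforward (lebesgue_measure \x m) (@rV_cons n).

Let step0 : lebesgue_rV_step set0 = 0.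
Proof. by rewrite /lebesgue_rV_step /pushforward preimage_set0 measure0. Qed.

Let step_ge0 A : 0 <= lebesgue_rV_step A.
Proof. by rewrite /lebesgue_rV_step /pushforward; exact: measure_ge0. Qed.

Let step_sigma_additive : semi_sigma_additive lebesgue_rV_step.
Proof.
have mpre (A : set ('rV[R]_n.+1)) :
    measurable A -> measurable (@rV_cons n @^-1` A).
  by move=> mA; rewrite -[X in measurable X]setTI; exact: measurable_rV_cons.
move=> F mF tF mUF; rewrite /lebesgue_rV_step /pushforward preimage_bigcup.
apply: measure_semi_sigma_additive.
- by move=> k; exact: mpre.
- apply/trivIsetP => /= i j _ _ ij; rewrite -preimage_setI.
  by move/trivIsetP : tF => /(_ _ _ _ _ ij) ->//; rewrite preimage_set0.
- by rewrite -preimage_bigcup; exact: mpre.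
Qed.

HB.instance Definition _ := isMeasure.Build _ _ _
  lebesgue_rV_step step0 step_ge0 step_sigma_additive.

Let step_sigma_finite : sigma_finite setT lebesgue_rV_step.
Proof.
have [F TF mF] := product_sigma_finite lebesgue_measure m.
exists (fun k => @rV_uncons n @^-1` F k).
  by rewrite -preimage_bigcup -TF preimage_setT.
move=> k; have [mFk Fk] := mF k; split.
  by rewrite -[X in measurable X]setTI; exact: measurable_rV_uncons.
rewrite /lebesgue_rV_step /pushforward -comp_preimage.
by rewrite (_ : _ \o _ = id) //; apply/funext => x /=; rewrite rV_consK.
Qed.

HB.instance Definition _ := Measure_isSigmaFinite.Build _ _ _
  lebesgue_rV_step step_sigma_finite.

End step.

(* Lebesgue measure on R^n: the n-fold product of one-dimensional Lebesgue
   measure. *)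
Fixpoint lebesgue_rV (n : nat) : {sigma_finite_measure set 'rV[R]_n -> \bar R} :=
  match n with
  | 0 => \d_(0 : 'rV[R]_0)
  | n'.+1 => lebesgue_rV_step (lebesgue_rV n')
  end.

End lebesgue_rV.

Lemma lebesgue_rV_box (R : realType) n (a b : 'rV[R]_n) :
  (forall i, a ord0 i <= b ord0 i) ->
  lebesgue_rV n [set v : 'rV[R]_n | forall i, a ord0 i <= v ord0 i <= b ord0 i] =
  (\prod_(i < n) (b ord0 i - a ord0 i))%:E.
Proof.
elim: n a b => [|n IH] a b ab /=.
  by rewrite big_ord0 diracE mem_set// => -[].
pose a' : 'rV[R]_n := \row_i a ord0 (lift ord0 i).
pose b' : 'rV[R]_n := \row_i b ord0 (lift ord0 i).
transitivity ((lebesgue_measure \x lebesgue_rV n)%E (`[a ord0 ord0, b ord0 ord0]%classic `*`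
    [set v : 'rV[R]_n | forall i, a' ord0 i <= v ord0 i <= b' ord0 i])); last first.
  have mbox : measurable [set v : 'rV[R]_n | forall i, a' ord0 i <= v ord0 i <= b' ord0 i].
    rewrite (_ : [set v | _] = \bigcap_(i in [set: 'I_n])
      [set v : 'rV[R]_n | `[a' ord0 i, b' ord0 i]%classic (v ord0 i)]).
      apply: fin_bigcap_measurable => // i _.
      have := measurable_rV_coord i measurableT
        (measurable_itv `[a' ord0 i, b' ord0 i]).
      by rewrite setTI.
    apply/seteqP; split=> v; first by move=> av i _ /=; rewrite in_itv/=.
    by move=> av i; have := av i I; rewrite /= in_itv.
  rewrite product_measure1E//.
  rewrite IH => [|i]; last by rewrite !mxE.
  rewrite /= lebesgue_measure_itv/= big_ord_recl.
  under eq_bigr do rewrite !mxE.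
  rewrite EFinM lte_fin lt_neqAle ab andbT.
  by case: eqVneq => [->|_] /=; rewrite ?subrr ?mul0e ?EFinB.
apply: (congr1 (lebesgue_measure \x lebesgue_rV n)%E).
apply/seteqP; split=> -[x v].
  move=> H; split; first by have := H ord0; rewrite rV_consE /= in_itv.
  by move=> i; have := H (lift ord0 i); rewrite rV_consE !mxE.
move=> [/= + H] i; rewrite in_itv/= => Hx.
case: (unliftP ord0 i) => [j|] ->; rewrite rV_consE//=.
by have := H j; rewrite !mxE.
Qed.

Section euclidean.
Context {R : realType} {n : nat}.
Implicit Types (x y v : 'rV[R]_n) (A : set 'rV[R]_n).

(* The norm of the library on ['rV_n] is the sup norm. *)
Definition enorm v : R := Num.sqrt (\sum_(i < n) v ord0 i ^+ 2).

Definition edist x y : R := enorm (x - y).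

Definition eball x (r : R) : set 'rV[R]_n := [set y | edist x y < r].

Definition ediam A : \bar R :=
  ereal_sup (0%E |` [set (edist x y)%:E | x in A & y in A]).

Lemma edist_ge0 x y : 0 <= edist x y.
Proof. exact: sqrtr_ge0. Qed.

Lemma ler_coord_edist x y i : `|x ord0 i - y ord0 i| <= edist x y.
Proof.
rewrite /edist /enorm -sqrtr_sqr ler_wsqrtr// (bigD1 i)//= !mxE lerDl.
by apply: sumr_ge0 => j _; exact: sqr_ge0.
Qed.

Lemma ediam_ge0 A : (0 <= ediam A)%E.
Proof. by apply: ereal_sup_ubound; left. Qed.

Lemma edist_le_ediam A x y : A x -> A y -> ((edist x y)%:E <= ediam A)%E.
Proof. by move=> Ax Ay; apply: ereal_sup_ubound; right; exists x => //; exists y. Qed.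

Lemma le_ediam A A' : A `<=` A' -> (ediam A <= ediam A')%E.
Proof.
move=> AA'; apply/ereal_supP => z [->|[x Ax [y Ay <-]]]; first exact: ediam_ge0.
by apply: ereal_sup_ubound; right; exists x; [exact: AA'|exists y => //; exact: AA'].
Qed.

End euclidean.

Section hausdorff.
Context {R : realType} {n : nat}.
Implicit Types (A B U : set 'rV[R]_n) (Q d : R).
Local Open Scope ereal_scope.

Definition hausdorff_gauge Q U : \bar R :=
  if U == set0 then 0 else ediam U `^ Q.

Definition hausdorff_content Q d A : \bar R :=
  ereal_inf [set \sum_(k <oo) hausdorff_gauge Q (U k) | U in
    [set U : (set 'rV[R]_n)^nat |
      A `<=` \bigcup_k U k /\ forall k, ediam (U k) <= d%:E]].

(* Unnormalised: no multiplicative constant in front of diam(U)^Q. *)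
Definition hausdorff_measure Q A : \bar R :=
  ereal_sup [set hausdorff_content Q d A | d in [set d : R | (0 < d)%R]].

Lemma hausdorff_gauge_ge0 Q U : 0 <= hausdorff_gauge Q U.
Proof. by rewrite /hausdorff_gauge; case: ifP => // _; exact: poweR_ge0. Qed.

Lemma hausdorff_gauge0 Q : hausdorff_gauge Q set0 = 0.
Proof. by rewrite /hausdorff_gauge eqxx. Qed.

Let discrete := g_sigma_algebraType [set: set 'rV[R]_n].

Let cut_gauge Q d (U : set discrete) : \bar R :=
  if ediam (U : set 'rV[R]_n) <= d%:E then hausdorff_gauge Q U else +oo.

Let cut_gauge_ge0 Q d U : 0 <= cut_gauge Q d U.
Proof. by rewrite /cut_gauge; case: ifP => // _; exact: hausdorff_gauge_ge0. Qed.

Let ediam0 : ediam (set0 : set 'rV[R]_n) = 0.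
Proof.
apply/eqP; rewrite eq_le ediam_ge0 andbT.
by apply/ereal_supP => z [->//|[x []]].
Qed.

Let cut_gauge0 Q d : (0 < d)%R -> cut_gauge Q d set0 = 0.
Proof.
by move=> d0; rewrite /cut_gauge ediam0 lee_fin ltW// hausdorff_gauge0.
Qed.

Let hausdorff_contentE Q d A : hausdorff_content Q d A = mu_ext (cut_gauge Q d) A.
Proof.
apply/eqP; rewrite eq_le; apply/andP; split; last first.
  apply: ereal_inf_le_tmp => _ [U [AU dU] <-]; exists U.
    by split=> // k; exact: sub_sigma_algebra.
  by apply: eq_eseriesr => k _; rewrite /cut_gauge dU.
apply/ereal_infP => _ [U [_ AU] <-].
have [dU|] := pselect (forall k, ediam (U k : set 'rV[R]_n) <= d%:E).
  apply: ereal_inf_lbound; exists U => //.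
  by apply: eq_eseriesr => k _; rewrite /cut_gauge dU.
move=> /existsNP[k /negP dUk]; rewrite (@eseries_pinfty _ _ _ k) ?leey//.
  by move=> i _; rewrite gt_eqF// (lt_le_trans _ (cut_gauge_ge0 _ _ _)).
by rewrite /cut_gauge (negbTE dUk).
Qed.

Lemma hausdorff_content_ge0 Q d A : 0 <= hausdorff_content Q d A.
Proof. by rewrite hausdorff_contentE; exact: mu_ext_ge0. Qed.

Lemma le_hausdorff_contentl Q d d' A : (d <= d')%R ->
  hausdorff_content Q d' A <= hausdorff_content Q d A.
Proof.
move=> dd'; apply: ereal_inf_le_tmp => _ [U [AU dU] <-]; exists U => //.
by split=> // k; rewrite (le_trans (dU k)).
Qed.

Lemma hausdorff_content_le Q d A : (0 < d)%R ->
  hausdorff_content Q d A <= hausdorff_measure Q A.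
Proof. by move=> d0; apply: ereal_sup_ubound; exists d. Qed.

Let hausdorff_ge0 Q A : 0 <= hausdorff_measure Q A.
Proof. exact: le_trans (hausdorff_content_ge0 _ _ _) (hausdorff_content_le _ _ ltr01). Qed.

Let hausdorff0 Q : hausdorff_measure Q set0 = 0.
Proof.
apply/eqP; rewrite eq_le hausdorff_ge0 andbT; apply/ereal_supP => _ [d d0 <-].
by rewrite hausdorff_contentE mu_ext0//; exact: cut_gauge0.
Qed.

Let le_hausdorff Q : {homo hausdorff_measure Q : A B / A `<=` B >-> A <= B}.
Proof.
move=> A B AB; apply/ereal_supP => _ [d d0 <-].
apply: le_trans (hausdorff_content_le Q B d0).
by rewrite !hausdorff_contentE; exact: le_mu_ext.
Qed.

Let hausdorff_sigma_subadditive Q : sigma_subadditive (hausdorff_measure Q).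
Proof.
move=> F; apply/ereal_supP => _ [d d0 <-].
apply: (@le_trans _ _ (\sum_(i <oo) hausdorff_content Q d (F i))).
  rewrite hausdorff_contentE.
  under eq_eseriesr do rewrite hausdorff_contentE.
  apply: mu_ext_sigma_subadditive => //; exact: cut_gauge0.
apply: lee_nneseries => [i _ _|i _]; first exact: hausdorff_content_ge0.
exact: hausdorff_content_le.
Qed.

HB.instance Definition _ Q := isOuterMeasure.Build R 'rV[R]_n
  (hausdorff_measure Q) (hausdorff0 Q) (hausdorff_ge0 Q) (@le_hausdorff Q)
  (@hausdorff_sigma_subadditive Q).

Lemma hausdorff_separated Q A B (e : R) : (0 < e)%R ->
  (forall x y, A x -> B y -> (e <= edist x y)%R) ->
  hausdorff_measure Q A + hausdorff_measure Q B <= hausdorff_measure Q (A `|` B).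
Proof.
move=> e0 AB.
have sep d : (0 < d)%R -> (d < e)%R ->
    hausdorff_content Q d A + hausdorff_content Q d B <=
    hausdorff_content Q d (A `|` B).
  move=> d0 de; apply/ereal_infP => _ [U [ABU dU] <-].
  pose V C k := if U k `&` C == set0 then set0 else U k.
  have VU C k : V C k `<=` U k by rewrite /V; case: ifP => [_ x []|_].
  have CV C : C `<=` A `|` B ->
      hausdorff_content Q d C <= \sum_(k <oo) hausdorff_gauge Q (V C k).
    move=> CAB; apply: ereal_inf_lbound; exists (V C) => //; split=> [x Cx|k].
      have [k _ Ukx] := ABU x (CAB x Cx); exists k => //.
      by rewrite /V; case: eqP => // UC0; suff : set0 x by []; rewrite -UC0.
    exact: le_trans (le_ediam (VU C k)) (dU k).
  apply: (le_trans (leeD (CV A (@subsetUl _ A B)) (CV B (@subsetUr _ A B)))).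
  rewrite -nneseriesD; [|by move=> *; exact: hausdorff_gauge_ge0..].
  apply: lee_nneseries => [k _ _|k _].
    by rewrite adde_ge0// hausdorff_gauge_ge0.
  rewrite /V; case: eqP => [_|/eqP/set0P[x [Ux Ax]]].
    by rewrite hausdorff_gauge0 add0e; case: eqP => // _;
      rewrite hausdorff_gauge0 hausdorff_gauge_ge0.
  case: eqP => [_|/eqP/set0P[y [Uy By]]].
    by rewrite hausdorff_gauge0 adde0.
  have := le_trans (edist_le_ediam Ux Uy) (dU k); rewrite lee_fin => xyd.
  by have := lt_le_trans de (le_trans (AB x y Ax By) xyd); rewrite ltxx.
have AAB : hausdorff_measure Q A <= hausdorff_measure Q (A `|` B).
  by apply: le_hausdorff => x; left.
have BAB : hausdorff_measure Q B <= hausdorff_measure Q (A `|` B).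
  by apply: le_hausdorff => x; right.
have [->|ABoo] := eqVneq (hausdorff_measure Q (A `|` B)) +oo; first exact: leey.
have fin C : hausdorff_measure Q C <= hausdorff_measure Q (A `|` B) ->
    hausdorff_measure Q C \is a fin_num.
  by move=> CAB; rewrite ge0_fin_numE// (le_lt_trans CAB)// ltey.
have finc d C : (0 < d)%R ->
    hausdorff_measure Q C <= hausdorff_measure Q (A `|` B) ->
    hausdorff_content Q d C \is a fin_num.
  move=> d0 CAB; rewrite ge0_fin_numE ?hausdorff_content_ge0//.
  by rewrite (le_lt_trans (hausdorff_content_le Q C d0))// (le_lt_trans CAB)// ltey.
rewrite -leeBrDr ?fin//; apply/ereal_supP => _ [d1 d10 <-].
rewrite leeBrDr ?fin// -leeBrDl ?finc//; apply/ereal_supP => _ [d2 d20 <-].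
rewrite leeBrDl ?finc//.
pose d := Num.min (Num.min d1 d2) (e / 2)%R.
have d0 : (0 < d)%R by rewrite !lt_min d10 d20 divr_gt0.
have de : (d < e)%R.
  by rewrite gt_min; apply/orP; right; rewrite ltr_pdivrMr// ltr_pMr// ltr1n.
apply: le_trans (hausdorff_content_le Q (A `|` B) d0).
apply: le_trans (sep d d0 de); apply: leeD; apply: le_hausdorff_contentl.
  by rewrite !ge_min lexx.
by rewrite !ge_min lexx orbT.
Qed.

Let shell_sum Q X (h : 'rV[R]_n -> R) (S : nat -> set 'rV[R]_n) (b : bool) N :
  (forall x y, h x - h y <= edist x y)%R ->
  (forall k, S k = X `&` [set x | k.+2%:R^-1 < h x <= k.+1%:R^-1]%R) ->
  \sum_(0 <= k < N | odd k == b) hausdorff_measure Q (S k) <=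
  hausdorff_measure Q (\bigcup_(k in [set k | (k < N)%N && (odd k == b)]) S k).
Proof.
move=> hL SE; elim: N => [|N IH]; first by rewrite big_nil.
rewrite big_mkcond big_nat_recr//= -big_mkcond/=.
have [oN|oN] := eqVneq (odd N) b; last first.
  rewrite adde0; apply: (le_trans IH); apply: le_hausdorff.
  move=> x [k /= /andP[kN ok] Sk]; exists k => //=.
  by rewrite ok andbT (ltn_trans kN).
set T := \bigcup_(k in _) S k in IH.
apply: (@le_trans _ _ (hausdorff_measure Q T + hausdorff_measure Q (S N))).
  exact: leeD.
apply: (@le_trans _ _ (hausdorff_measure Q (T `|` S N))); last first.
  apply: le_hausdorff => x [[k /= /andP[kN ok] Sk]|SN].
    by exists k => //=; rewrite ok andbT (ltn_trans kN).
  by exists N => //=; rewrite oN eqxx ltnSn.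
case: N oN {IH} @T => [|N] oN T.
  rewrite (_ : T = set0) ?set0U ?hausdorff0 ?add0e//.
  by apply/seteqP; split=> // x [].
apply: (@hausdorff_separated _ _ _ (N.+1%:R^-1 - N.+2%:R^-1)%R).
  by rewrite subr_gt0 ltf_pV2 ?posrE// ltr_nat.
move=> x y [k /= /andP[kN ok]]; rewrite !SE => -[_ /= /andP[hx _]].
move=> [_ /= /andP[_ hy]]; apply: le_trans (hL x y).
apply: lerB => //; apply: le_trans (ltW hx).
rewrite lef_pV2 ?posrE// ler_nat.
move: kN; rewrite ltnS leq_eqVlt => /predU1P[kN|//].
by move: ok oN; rewrite kN /= => /eqP <-; case: (odd N).
Qed.

Lemma hausdorff_caratheodory_le0 Q (h : 'rV[R]_n -> R) :
  (forall x y, h x - h y <= edist x y)%R ->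
  (hausdorff_measure Q).-caratheodory [set x | h x <= 0]%R.
Proof.
move=> hL; apply: le_caratheodory_measurable => X /=; set F := [set x | _].
have [->|Xoo] := eqVneq (hausdorff_measure Q X) +oo; first exact: leey.
have Xfin : hausdorff_measure Q X \is a fin_num by rewrite ge0_fin_numE// ltey.
pose S k := X `&` [set x | k.+2%:R^-1 < h x <= k.+1%:R^-1]%R.
have Sfin : \sum_(k <oo) hausdorff_measure Q (S k) < +oo.
  apply: (@le_lt_trans _ _ (hausdorff_measure Q X + hausdorff_measure Q X)).
    apply: lime_le; first exact: is_cvg_nneseries.
    near=> N; rewrite (bigID (fun k => odd k == true))/= leeD//.
      apply: (le_trans (@shell_sum Q X h S true N hL (fun=> erefl))).
      by apply: le_hausdorff => x [k _ []].
    rewrite (eq_bigl (fun k => odd k == false)); last by move=> k; case: odd.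
    apply: (le_trans (@shell_sum Q X h S false N hL (fun=> erefl))).
    by apply: le_hausdorff => x [k _ []].
  by rewrite lte_add_pinfty// ltey.
have tail := nneseries_tail_cvg Sfin (fun k _ => hausdorff_ge0 Q (S k)).
apply/lee_addgt0Pr => e e0.
have [N SN] : exists N, \sum_(N <= k <oo) hausdorff_measure Q (S k) <= e%:E.
  have : \forall N \near \oo, \sum_(N <= k <oo) hausdorff_measure Q (S k) < e%:E.
    apply: (tail [set x | x < e%:E]); apply: open_nbhs_nbhs.
    by split; [exact: open_ereal_lt_ereal|rewrite /= lte_fin].
  by case=> N _ /(_ N (leqnn N))/= /ltW; exists N.
pose XN := X `&` [set x | N.+1%:R^-1 < h x]%R.
have XF : hausdorff_measure Q (X `&` F) + hausdorff_measure Q XN <=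
    hausdorff_measure Q X.
  rewrite addeC.
  apply: (@le_trans _ _ (hausdorff_measure Q (XN `|` (X `&` F)))); last first.
    by apply: le_hausdorff => x [[]|[]].
  apply: (@hausdorff_separated _ _ _ N.+1%:R^-1%R); first by rewrite invr_gt0.
  move=> x y [_ /= hx] [_ hy]; apply: le_trans (hL x y).
  by rewrite -[leLHS]subr0 lerB// ltW.
have XNF : hausdorff_measure Q (X `&` ~` F) <=
    hausdorff_measure Q XN + \sum_(N <= k <oo) hausdorff_measure Q (S k).
  pose G k := if k is k'.+1 then S (k' + N)%N else XN.
  apply: (@le_trans _ _ (hausdorff_measure Q (\bigcup_k G k))).
    apply: le_hausdorff => x [Xx /= /negP]; rewrite -ltNge => hx.
    have [Nx|xN] := ltP N.+1%:R^-1%R (h x); first by exists 0%N.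
    have ex : exists k, (k.+1%:R^-1 < h x)%R.
      have [k _ /(_ k (leqnn k))] := near_infty_natSinv_lt (PosNum hx).
      by exists k.
    case: (ex_minnP ex) => m mx mmin.
    have Nm : (N < m)%N.
      rewrite ltnNge; apply/negP => mN.
      have := lt_le_trans mx xN; rewrite ltf_pV2 ?posrE// ltr_nat.
      by rewrite ltnS ltnNge mN.
    case: m Nm mx mmin => // m Nm mx mmin.
    exists (m - N).+1 => //=; rewrite subnK//; split=> //=.
    rewrite mx/= leNgt; apply/negP => /mmin; by rewrite ltnn.
  apply: (le_trans (hausdorff_sigma_subadditive Q G)).
  rewrite nneseries_recl//= leeD2l//.
  rewrite -(@nneseries_addn _ (fun k => hausdorff_measure Q (G k)) 1)//.
  under eq_eseriesr do rewrite addn1/=.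
  by rewrite (nneseries_addn (f := fun k => hausdorff_measure Q (S k))).
apply: (le_trans (leeD2l _ XNF)); rewrite addeA; exact: leeD.
Unshelve. all: by end_near. Qed.

Let measurable_hausdorff_caratheodory Q :
  (measurable : set (set 'rV[R]_n)) `<=` (hausdorff_measure Q).-caratheodory.
Proof.
apply: rV_measurable_sub.
  split=> [|A cA|A cA].
  - exact: caratheodory_measurable_set0.
  - by rewrite setTD; exact: caratheodory_measurable_setC.
  - exact: caratheodory_measurable_bigcup.
move=> i Y mY.
have mf : @measurable_fun _ _ (caratheodory_type (hausdorff_measure Q)) R setT
    (fun v : 'rV[R]_n => v ord0 i).
  apply: (measurability _ (RGenOInfty.measurableE R)) => _ [_ [a ->] <-].
  rewrite setTI [X in measurable X](_ : _ =
    ~` [set v : 'rV[R]_n | v ord0 i - a <= 0]%R).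
    apply: caratheodory_measurable_setC; apply: hausdorff_caratheodory_le0.
    move=> x y; rewrite opprB addrA subrK.
    by rewrite (le_trans (ler_norm _))// ler_coord_edist.
  by apply/seteqP; split=> v /=; rewrite in_itv/= andbT subr_le0 ltNge => /negP.
by have := mf measurableT Y mY; rewrite setTI.
Qed.

Let hausdorff_sigma_additive Q : semi_sigma_additive (hausdorff_measure Q).
Proof.
move=> F mF tF mUF.
apply: (@caratheodory_measure_sigma_additive _ _ (hausdorff_measure Q)) => //.
  by move=> k; exact: measurable_hausdorff_caratheodory.
exact: measurable_hausdorff_caratheodory.
Qed.

HB.instance Definition _ Q := isMeasure.Build _ _ _ (hausdorff_measure Q)
  (hausdorff0 Q) (hausdorff_ge0 Q) (@hausdorff_sigma_additive Q).

End hausdorff.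

Section function_spaces.
Context {R : realType} {n : nat}.
Implicit Types (mu nu : {measure set 'rV[R]_n -> \bar R}) (p Q theta : R).
Implicit Types (B D E : set 'rV[R]_n) (f u : 'rV[R]_n -> R).
Implicit Types (g : 'rV[R]_n -> 'rV[R]_n).

Local Notation leb := (lebesgue_rV n).

Definition ahlfors_regular Q E : Prop := exists2 C : R, 1 <= C &
  forall x r, E x -> 0 < r -> (r%:E <= ediam E)%E ->
  ((C^-1 * r `^ Q)%:E <= hausdorff_measure Q (E `&` eball x r)
     <= (C * r `^ Q)%:E)%E.

Definition locally_integrable_rV D f : Prop := measurable_fun D f /\
  forall K, K `<=` D -> compact K -> (\int[leb]_(x in K) `|f x|%:E < +oo)%E.

Definition weighted_measure mu : Prop := exists w : 'rV[R]_n -> R,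
  [/\ forall x, 0 <= w x, locally_integrable_rV setT w &
      forall A, measurable A -> mu A = (\int[leb]_(x in A) (w x)%:E)%E].

Definition iter_partial (s : seq 'I_n) f : 'rV[R]_n -> R :=
  foldr (fun i (h : 'rV[R]_n -> R) x => 'D_(delta_mx ord0 i) h x) f s.

Definition smooth f : Prop := forall s : seq 'I_n,
  continuous (iter_partial s f) /\
  forall (i : 'I_n) x, derivable (iter_partial s f) x (delta_mx ord0 i).

Definition test_function B f : Prop :=
  [/\ smooth f, compact (closure [set x | f x != 0]) &
      closure [set x | f x != 0] `<=` B].

Definition weak_gradient B f g : Prop :=
  [/\ locally_integrable_rV B f,
      forall i, locally_integrable_rV B (fun x => g x ord0 i) &
      forall phi i, test_function B phi ->
        \int[leb]_(x in B) (f x * 'D_(delta_mx ord0 i) phi x) =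
        - \int[leb]_(x in B) (g x ord0 i * phi x)].

(* f belongs to W^{1,p}(B, mu) and g represents its weak gradient, which is
   unique up to Lebesgue-null subsets of B; this is why [sobolev_norm] below
   can take the gradient as an argument. Restrictions [_ \_ B] extend by 0. *)
Definition sobolev_gradient mu p B f g : Prop :=
  [/\ f \_ B \in Lfun mu p%:E, weak_gradient B f g &
      (enorm \o g) \_ B \in Lfun mu p%:E].

Definition sobolev mu p B : set ('rV[R]_n -> R) :=
  [set f | exists g, sobolev_gradient mu p B f g].

Definition sobolev_norm mu p B f g : \bar R :=
  ('N[mu]_p%:E[EFin \o (f \_ B)] + 'N[mu]_p%:E[EFin \o ((enorm \o g) \_ B)])%E.

(* Balls of the metric measure space (B, mu) are traces on B of balls of R^n;
   in the Poincare inequality the center may lie outside B. *)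
Definition doubling_on mu B : Prop := exists2 C : R, 1 <= C &
  forall x r, B x -> 0 < r <= 10 ->
  (mu (eball x (2 * r) `&` B) <= C%:E * mu (eball x r `&` B))%E.

Definition average mu D f : R := (fine (mu D))^-1 * \int[mu]_(x in D) f x.

Definition poincare_on mu p B : Prop := exists2 C : R, 1 < C &
  forall f g, sobolev_gradient mu p B f g ->
  forall z r, 0 < r <= 10 -> eball z r `&` B !=set0 ->
  let D := eball z r `&` B in
  average mu D (fun x => `|f x - average mu D f|) <=
  C * r * average mu D (fun x => enorm (g x) `^ p) `^ p^-1.

(* On the diagonal the integrand is 0 * (nu set0)^-1 = 0 * +oo = 0. *)
Definition besov_energy nu E theta p u : \bar R :=
  (\int[nu]_(x in E) \int[nu]_(y in E)
     ((`|u y - u x| `^ p / edist x y `^ (theta * p))%:E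
        / nu (eball x (edist x y))))%E.

Definition besov nu E theta p : set ('rV[R]_n -> R) :=
  [set u | u \_ E \in Lfun nu p%:E /\ (besov_energy nu E theta p u < +oo)%E].

Definition besov_norm nu E theta p u : \bar R :=
  ('N[nu]_p%:E[EFin \o (u \_ E)] + besov_energy nu E theta p u `^ p^-1)%E.

Definition lipschitz_rV B u : Prop := exists L : R,
  forall x y, B x -> B y -> `|u x - u y| <= L * edist x y.

(* Elements of both spaces are represented by functions on R^n, of which only
   the values on B, resp. E, matter; equality in the Sobolev space is equality
   mu-a.e. on B and equality in the Besov space is equality nu-a.e. on E. *)
Definition bounded_linear_operator mu p B nu E theta
    (T : ('rV[R]_n -> R) -> ('rV[R]_n -> R)) : Prop :=
  [/\ forall f, sobolev mu p B f -> besov nu E theta p (T f),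
      forall f1 f2, sobolev mu p B f1 -> sobolev mu p B f2 ->
        {ae mu, forall x, B x -> f1 x = f2 x} ->
        {ae nu, forall x, E x -> T f1 x = T f2 x},
      forall (a : R) f1 f2, sobolev mu p B f1 -> sobolev mu p B f2 ->
        {ae nu, forall x, E x ->
          T (fun z => a * f1 z + f2 z) x = a * T f1 x + T f2 x} &
      exists C : R, forall f g, sobolev_gradient mu p B f g ->
        (besov_norm nu E theta p (T f) <= C%:E * sobolev_norm mu p B f g)%E].

End function_spaces.

(* Main.v *)
(* The trace of f at x is the limit of the averages of f over the balls of
   radius r_k = 2^(1-k) centered at x and intersected with B. Put a = n + alpha,
   s = Q - eta with 2 eta = p (1 - theta) - (a - Q) > 0, and let
     M(x) = int_B |grad f|^p(z) d(x,z)^(-s) dmu(z),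
   with a dyadic substitute for the Riesz kernel. The Poincare inequality bounds
   the difference of two averages over comparable nearby balls of radius about r
   by r^t M(x)^(1/p), where t = 1 + (s - a)/p = theta + eta/p. Telescoping gives
     |Tf(x) - Tf(y)|^p <= C d(x,y)^(tp) (M(x) + M(y)).
   Since tp - theta p - Q = -s, the Besov integrand is at most a multiple of
   d(x,y)^(-s) (M(x) + M(y)). As s < Q, the upper regularity of nu makes
   int_E d(x,z)^(-s) dnu(x) bounded in z, and two applications of Tonelli's
   theorem bound the energy by int_E M dnu, and then by int_B |grad f|^p dmu. *)

Require Import Defs.
From mathcomp Require Import all_boot all_order all_algebra.
From mathcomp Require Import all_classical all_reals all_analysis.
From mathcomp Require Import measurable_realfun ring lra.
Import Order.TTheory GRing.Theory Num.Theory.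
Import numFieldNormedType.Exports.
Local Open Scope classical_set_scope.
Local Open Scope ring_scope.
Set Implicit Arguments.
Unset Strict Implicit.

(* MathComp-Analysis has its own [edist]. *)
Local Notation edist := Defs.edist.

(** * Euclidean distance *)

(** Half of the slack [p (1 - theta) - (a - Q)] pays for lowering [s] below [Q], which makes the
    kernel integrable against [nu]. The other half survives in [t], and makes the exponent left over
    in the Besov integrand equal to the [-s] already present in [M], so that one kernel serves both
    purposes. The kernel is a dyadic sum because [s] is allowed to be negative: on a ball of radius
    [r] the inequality [r^(-s) <= d(x,z)^(-s)] then fails, whereas [r^(-s)] is a term of the sum for
    either sign of [s]. Where [M] is infinite the bounds on the Besov integrand and on [|Tf|^p] have
    an infinite right-hand side, so they hold at every point of [E]. That [M] is finite almost
    everywhere matters only for linearity, since limits superior do not add. All averages are over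
    balls cut by [B]; the inclusion of [E] in the half ball keeps their mass comparable to [r^a]. *)

Section euclidean_metric.
Context {R : realType} {n : nat}.
Implicit Types (x y z v w : 'rV[R]_n) (r : R).

Lemma edistxx x : edist x x = 0.
Proof.
by rewrite /edist /enorm subrr big1 ?sqrtr0// => i _; rewrite mxE expr0n.
Qed.

Lemma edistC x y : edist x y = edist y x.
Proof.
by congr Num.sqrt; apply: eq_bigr => i _; rewrite !mxE -sqrrN opprB.
Qed.

Lemma edist_gt0 x y : x != y -> 0 < edist x y.
Proof.
move=> xy; rewrite lt_neqAle Defs.edist_ge0 andbT; apply: contra_neq xy => d0.
apply/rowP => i; apply/eqP; rewrite -subr_eq0 -normr_le0 d0.
exact: ler_coord_edist.
Qed.

Lemma enorm_sqr v : enorm v ^+ 2 = \sum_(i < n) v ord0 i ^+ 2.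
Proof. by rewrite sqr_sqrtr//; apply: sumr_ge0 => i _; exact: sqr_ge0. Qed.

Lemma enorm_ge0 v : 0 <= enorm v.
Proof. exact: sqrtr_ge0. Qed.

Lemma ler_coord_enorm v i : `|v ord0 i| <= enorm v.
Proof.
by have := ler_coord_edist v 0 i; rewrite /edist subr0 !mxE subr0.
Qed.

Lemma enorm_cauchy_schwarz v w :
  \sum_(i < n) v ord0 i * w ord0 i <= enorm v * enorm w.
Proof.
have [v0|v0] := eqVneq (enorm v) 0.
  rewrite v0 mul0r big1// => i _.
  have := ler_coord_enorm v i; rewrite v0 normr_le0 => /eqP ->; exact: mul0r.
have [w0|w0] := eqVneq (enorm w) 0.
  rewrite w0 mulr0 big1// => i _.
  have := ler_coord_enorm w i; rewrite w0 normr_le0 => /eqP ->; exact: mulr0.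
have vp : 0 < enorm v by rewrite lt_neqAle eq_sym v0 enorm_ge0.
have wp : 0 < enorm w by rewrite lt_neqAle eq_sym w0 enorm_ge0.
pose a := enorm v; pose b := enorm w.
(* Weighted AM-GM in each coordinate: with the weights [b / a] and [a / b] each half sums to
   [a * b / 2]. *)
apply: (@le_trans _ _ (\sum_(i < n)
    (2^-1 * (b / a) * v ord0 i ^+ 2 + 2^-1 * (a / b) * w ord0 i ^+ 2))).
  apply: ler_sum => i _; set x := v ord0 i; set y := w ord0 i.
  rewrite -subr_ge0 (_ : _ - _ = (2 * a * b)^-1 * (b * x - a * y) ^+ 2); last first.
    by rewrite /a /b; field; rewrite v0 w0.
  by rewrite mulr_ge0 ?sqr_ge0// invr_ge0 !mulr_ge0// ltW.
rewrite big_split/= -!mulr_sumr -!enorm_sqr -/a -/b.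
by rewrite le_eqVlt; apply/orP; left; apply/eqP; rewrite /a /b; field; rewrite v0 w0.
Qed.

Lemma enormD v w : enorm (v + w) <= enorm v + enorm w.
Proof.
rewrite -(@ler_pXn2r _ 2) ?nnegrE ?addr_ge0 ?enorm_ge0//.
rewrite enorm_sqr sqrrD !enorm_sqr.
under eq_bigr do rewrite mxE sqrrD.
rewrite !big_split/= lerD2r lerD2l -mulr2n lerMn2r//=.
exact: enorm_cauchy_schwarz.
Qed.

Lemma edist_triangle y x z : edist x z <= edist x y + edist y z.
Proof.
by rewrite /edist (_ : x - z = (x - y) + (y - z)) ?enormD// addrA subrK.
Qed.

Lemma eball_center x r : 0 < r -> eball x r x.
Proof. by rewrite /eball/= edistxx. Qed.

Lemma eball_sub x y r s : edist x y + s <= r -> eball y s `<=` eball x r.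
Proof.
move=> h z; rewrite /eball/= => yz; apply: le_lt_trans (edist_triangle y x z) _.
by apply: lt_le_trans h; rewrite ltrD2l.
Qed.

Lemma eball_le x r s : r <= s -> eball x r `<=` eball x s.
Proof. by move=> rs; apply: eball_sub; rewrite edistxx add0r. Qed.

Lemma measurable_edist :
  measurable_fun setT (fun z : 'rV[R]_n * 'rV[R]_n => edist z.1 z.2).
Proof.
apply: (@measurableT_comp _ _ _ _ _ _ (@Num.sqrt R)).
  by apply: continuous_measurable_fun; exact: sqrt_continuous.
rewrite (_ : (fun _ => _) = (fun z : 'rV[R]_n * 'rV[R]_n =>
   \sum_(i < n) (z.1 ord0 i - z.2 ord0 i) ^+ 2)); last first.
  by apply/funext => z; apply: eq_bigr => i _; rewrite !mxE.
apply: measurable_sum => i; apply: measurable_funX.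
apply: measurable_funB;
  exact: (measurableT_comp (measurable_rV_coord i)).
Qed.

Lemma measurable_edistr x : measurable_fun setT (edist x : 'rV[R]_n -> R).
Proof.
exact: (measurableT_comp measurable_edist (pair1_measurable x)).
Qed.

Lemma measurable_eball_pair r :
  measurable [set z : 'rV[R]_n * 'rV[R]_n | edist z.1 z.2 < r].
Proof.
have := measurable_edist measurableT (measurable_itv `]-oo, r[).
by rewrite setTI.
Qed.

Lemma measurable_eball x r : measurable (eball x r).
Proof.
have := measurable_edistr x measurableT (measurable_itv `]-oo, r[).
by rewrite setTI.
Qed.

(** The crude factor [n], instead of its square root, is enough to see that Euclidean balls are
    open. *)
Lemma edist_le_norm x y : edist x y <= n%:R * `|x - y|.
Proof.
rewrite -(@ler_pXn2r _ 2) ?nnegrE ?Defs.edist_ge0 ?mulr_ge0//.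
rewrite enorm_sqr.
apply: (@le_trans _ _ (\sum_(i < n) `|x - y| ^+ 2)).
  apply: ler_sum => i _; rewrite -real_normK ?num_real//.
  rewrite ler_pXn2r ?nnegrE//.
  rewrite [leRHS]/Num.Def.normr/= mx_normrE.
  exact: (le_bigmax _ (fun ij => `|(x - y) ij.1 ij.2|) (ord0, i)).
rewrite sumr_const card_ord exprMn -[leLHS]mulr_natl ler_wpM2r ?sqr_ge0//.
rewrite -natrX ler_nat expnS expn1; by case: (n) => // k; rewrite leq_pmulr.
Qed.

Lemma eball_open x r : open (eball x r).
Proof.
rewrite openE => y /= xy; rewrite /interior.
pose e := (r - edist x y) / n.+1%:R.
have e0 : 0 < e by rewrite divr_gt0// subr_gt0.
apply/nbhs_ballP; exists e => //= z; rewrite -ball_normE/= => yz.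
apply: (@eball_sub x y r (r - edist x y)) => //; first by rewrite addrC subrK.
rewrite /eball/=; apply: le_lt_trans (edist_le_norm y z) _.
have : n.+1%:R * `|y - z| < r - edist x y by rewrite mulrC -ltr_pdivlMr.
by apply: le_lt_trans; rewrite ler_wpM2r// ler_nat.
Qed.

End euclidean_metric.

(** * Ahlfors regular sets *)

Section hausdorff_bounds.
Context {R : realType} {n : nat}.
Implicit Types (E : set 'rV[R]_n) (Q : R).

(** Regularity says nothing about a set of diameter 0, as no radius is admissible there. Since
    [0 < Q], covering [E] by copies of itself costs nothing. *)
Lemma hausdorff_measure_point Q E : 0 < Q -> ediam E = 0%E ->
  hausdorff_measure Q E = 0%E.
Proof.
move=> Q0 E0; apply/eqP; rewrite eq_le measure_ge0 andbT.
apply/ereal_supP => _ [d /= d0 <-]; apply: ereal_inf_lbound.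
exists (fun=> E); first by split=> [x Ex|k]; [exists 0%N|rewrite E0 lee_fin ltW].
apply: eseries0 => k _ _; rewrite /hausdorff_gauge; case: ifP => // _.
by rewrite E0 poweR0r// gt_eqF.
Qed.

(** An open ball of radius diam(E) about a point of [E] can miss points at exactly that distance. By
    compactness finitely many such balls cover [E], and regularity bounds each of them. *)
Lemma hausdorff_compact_lty Q E (cE : compact E) : ahlfors_regular Q E ->
  (0 < ediam E)%E -> (ediam E <= 1)%E -> (hausdorff_measure Q E < +oo)%E.
Proof.
move=> [C C1 HC] E0 E1.
have Efin : ediam E \is a fin_num by rewrite ge0_fin_numE ?ediam_ge0// (le_lt_trans E1)// ltry.
pose r := fine (ediam E).
have rE : r%:E = ediam E by rewrite fineK.
have r0 : 0 < r by rewrite -lte_fin rE.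
have := cE; rewrite compact_cover => /(_ _ E (fun x => eball x r)).
case=> [x _|x Ex|D DE ED].
- exact: eball_open.
- by exists x => //; exact: eball_center.
have mE := compact_measurable_rV cE.
have mEb x : measurable (E `&` eball x r).
  by apply: measurableI => //; exact: measurable_eball.
apply: (@le_lt_trans _ _ (hausdorff_measure Q
    (\big[setU/set0]_(x <- finmap.enum_fset D) (E `&` eball x r)))).
  apply: le_measure; rewrite ?inE//; first exact: bigsetU_measurable.
  move=> x Ex; have [i iD xi] := ED x Ex.
  by rewrite -bigcup_seq; exists i.
have : forall x, x \in finmap.enum_fset D -> E x.
  by move=> x xD; apply/set_mem/DE.
elim: (finmap.enum_fset D) => [_|x s IH sE]; first by rewrite big_nil measure0.
rewrite big_cons; apply: le_lt_trans (measureU2 _ _ _) _ => //.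
  exact: bigsetU_measurable.
apply: lte_add_pinfty; last first.
  by apply: IH => y ys; apply: sE; rewrite inE ys orbT.
have := HC x r (sE x (mem_head x s)) r0.
rewrite rE lexx => /(_ isT)/andP[_ /le_lt_trans]; by apply; rewrite ltry.
Qed.

(* Radii above the diameter are covered by the finiteness of the measure of
   [E], and arbitrary centers by doubling the radius. *)
Lemma ahlfors_regular_upper Q E : compact E -> 0 < Q -> ahlfors_regular Q E ->
  (ediam E <= 1)%E ->
  exists2 C : R, 0 < C & forall z r, 0 < r ->
    (hausdorff_measure Q (E `&` eball z r) <= (C * r `^ Q)%:E)%E.
Proof.
move=> cE Q0 aE E1; have mE := compact_measurable_rV cE.
have mEb x r : measurable (E `&` eball x r).
  by apply: measurableI => //; exact: measurable_eball.
have HEb x r : (hausdorff_measure Q (E `&` eball x r) <= hausdorff_measure Q E)%E.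
  by apply: le_measure; rewrite ?inE//; exact: subIsetl.
have := ediam_ge0 E; rewrite le_eqVlt => /predU1P[E0|E0].
  exists 1 => // z r r0.
  by rewrite (le_trans (HEb z r))// hausdorff_measure_point// lee_fin mul1r powR_ge0.
have Hfin := hausdorff_compact_lty cE aE E0 E1.
have Efin : ediam E \is a fin_num.
  by rewrite ge0_fin_numE ?ediam_ge0// (le_lt_trans E1)// ltry.
case: aE => C C1 HC; pose d := fine (ediam E).
have dE : d%:E = ediam E by rewrite fineK.
have d0 : 0 < d by rewrite -lte_fin dE.
have HEfin : hausdorff_measure Q E \is a fin_num.
  by rewrite ge0_fin_numE ?measure_ge0.
pose H := fine (hausdorff_measure Q E).
have HE : H%:E = hausdorff_measure Q E by rewrite fineK.
have H0 : 0 <= H by rewrite fine_ge0.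
have C0 : 0 < C by rewrite (lt_le_trans _ C1).
exists ((C + H / d `^ Q) * 2 `^ Q) => [|z r r0].
  by rewrite mulr_gt0 ?powR_gt0// ltr_wpDr// divr_ge0 ?powR_ge0.
have r0' := ltW r0; rewrite -mulrA -powRM//.
have [->|/set0P[x [Ex zx]]] := eqVneq (E `&` eball z r) set0.
  rewrite measure0 lee_fin mulr_ge0 ?powR_ge0// addr_ge0 ?divr_ge0 ?powR_ge0//.
  exact: ltW.
have r20 : 0 < 2 * r by rewrite mulr_gt0.
apply: (@le_trans _ _ (hausdorff_measure Q (E `&` eball x (2 * r)))).
  apply: le_measure; rewrite ?inE//; apply: setIS; apply: eball_sub.
  by rewrite edistC mulr2n mulrDl mul1r lerD2r ltW.
have [rd|dr] := leP (2 * r) d.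
  have := HC x (2 * r) Ex r20; rewrite -dE lee_fin => /(_ rd)/andP[_].
  move=> /le_trans; apply; rewrite lee_fin ler_wpM2r ?powR_ge0//.
  by rewrite lerDl divr_ge0 ?powR_ge0.
apply: le_trans (HEb _ _) _; rewrite -HE lee_fin mulrDl.
apply: ler_wpDl; first by rewrite mulr_ge0 ?powR_ge0// ltW.
rewrite mulrAC ler_pdivlMr ?powR_gt0// ler_wpM2l//.
by rewrite ge0_ler_powR ?nnegrE// ltW.
Qed.

End hausdorff_bounds.

(** * Integrals on subsets *)

Section restricted_integrals.
Local Open Scope ereal_scope.
Context d (T : measurableType d) {R : realType}.
Variables (mu : {measure set T -> \bar R}) (D : set T) (mD : measurable D).

Import HBNNSimple.

(* Unlike in [ge0_le_integral], no measurability enters: both integrals are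
   suprema over simple functions. *)
Lemma ge0_subset_le_integral (f g : T -> \bar R) :
  (forall x, D x -> 0 <= f x) -> (forall x, D x -> f x <= g x) ->
  \int[mu]_(x in D) f x <= \int[mu]_(x in D) g x.
Proof.
move=> f0 fg; rewrite !(integral_mkcond D) !ge0_integralTE//; last 2 first.
- move=> x; apply: erestrict_ge0 => y Dy; exact: le_trans (f0 y Dy) (fg y Dy).
- by move=> x; exact: erestrict_ge0.
apply/ereal_supP => _ [h hf <-]; apply: ereal_sup_ubound; exists h => // x; apply: le_trans (hf x) _.
by rewrite /patch; case: ifPn => // /set_mem; exact: fg.
Qed.

(** [mfrestr] is a finite measure, so Tonelli's theorem becomes available for measures that are
    finite on the domain but not given as sigma-finite. *)
Lemma integral_mfrestr (muD : mu D < +oo) (f : T -> \bar R) :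
  \int[mu]_(x in D) f x = \int[mfrestr mD muD]_x (f \_ D) x.
Proof.
rewrite -integral_mkcond; apply: eq_measure_integral => A mA AD.
by rewrite /= /mfrestr /mrestr setIidl.
Qed.

End restricted_integrals.

Section restricted_tonelli.
Local Open Scope ereal_scope.
Context d1 d2 (T1 : measurableType d1) (T2 : measurableType d2) {R : realType}.
Variables (m1 : {measure set T1 -> \bar R}) (m2 : {measure set T2 -> \bar R}).
Variables (D1 : set T1) (D2 : set T2).
Hypotheses (mD1 : measurable D1) (mD2 : measurable D2).
Hypotheses (m1D1 : m1 D1 < +oo) (m2D2 : m2 D2 < +oo).
Variable f : T1 * T2 -> \bar R.
Hypotheses (f0 : forall z, 0 <= f z) (mf : measurable_fun setT f).

Let f' z := f z * (\1_(D1 `*` D2) z)%:E.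

Let mf' : measurable_fun setT f'.
Proof.
apply: emeasurable_funM => //; apply/measurable_EFinP.
by apply: measurable_indic; exact: measurableX.
Qed.

Let f'0 z : 0 <= f' z.
Proof. by rewrite mule_ge0// lee_fin. Qed.

Lemma measurable_fun_integral_in :
  measurable_fun setT (fun x => \int[m2]_(y in D2) f (x, y)).
Proof.
(* Only the second variable is cut off, since measurability is claimed for all [x]. *)
pose g z := f z * (\1_(setT `*` D2) z)%:E.
have mg : measurable_fun setT g.
  apply: emeasurable_funM => //; apply/measurable_EFinP.
  by apply: measurable_indic; exact: measurableX.
have g0 z : 0 <= g z by rewrite mule_ge0// lee_fin.
have := @measurable_fun_fubini_tonelli_F _ _ _ _ _ (mfrestr mD2 m2D2) g mg g0.
congr measurable_fun; apply/funext => x; rewrite (integral_mfrestr mD2 m2D2).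
apply: eq_integral => y _; rewrite /g patchE indicE in_setX in_setT/=.
by case: ifPn; rewrite ?mule1 ?mule0.
Qed.

Lemma fubini_tonelli_in :
  \int[m1]_(x in D1) \int[m2]_(y in D2) f (x, y) =
  \int[m2]_(y in D2) \int[m1]_(x in D1) f (x, y).
Proof.
have := @fubini_tonelli _ _ _ _ _ (mfrestr mD1 m1D1) (mfrestr mD2 m2D2) _ mf' f'0.
rewrite (_ : \int[_]_x _ = \int[m1]_(x in D1) \int[m2]_(y in D2) f (x, y)).
  move=> ->; rewrite [RHS](integral_mfrestr mD2 m2D2).
  apply: eq_integral => y _; rewrite patchE; case: ifPn => yD2; last first.
    rewrite integral0_eq// => x _.
    by rewrite /f' indicE in_setX (negbTE yD2) andbF mule0.
  rewrite (integral_mfrestr mD1 m1D1); apply: eq_integral => x _.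
  rewrite patchE /f' indicE in_setX yD2 andbT.
  by case: ifPn; rewrite ?mule1 ?mule0.
rewrite [RHS](integral_mfrestr mD1 m1D1).
apply: eq_integral => x _; rewrite patchE; case: ifPn => xD1; last first.
  rewrite integral0_eq// => y _.
  by rewrite /f' indicE in_setX (negbTE xD1) mule0.
rewrite (integral_mfrestr mD2 m2D2); apply: eq_integral => y _.
rewrite patchE /f' indicE in_setX xD1/=.
by case: ifPn; rewrite ?mule1 ?mule0.
Qed.

End restricted_tonelli.

Section schur.
Local Open Scope ereal_scope.
Context d1 d2 (T1 : measurableType d1) (T2 : measurableType d2) {R : realType}.
Variables (m1 : {measure set T1 -> \bar R}) (m2 : {measure set T2 -> \bar R}).
Variables (D1 : set T1) (D2 : set T2).
Hypotheses (mD1 : measurable D1) (mD2 : measurable D2).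
Hypotheses (m1D1 : m1 D1 < +oo) (m2D2 : m2 D2 < +oo).
Variables (K : T1 * T2 -> \bar R) (h : T2 -> \bar R) (C : R).
Hypotheses (K0 : forall z, 0 <= K z) (mK : measurable_fun setT K).
Hypotheses (h0 : forall z, 0 <= h z) (mh : measurable_fun setT h).

(** The L^1 case of Schur's test: once the integrals are exchanged, [x] is integrated first and the
    kernel bound is uniform in [y]. *)
Lemma integral_kernel_le :
  (forall y, D2 y -> \int[m1]_(x in D1) K (x, y) <= C%:E) ->
  \int[m1]_(x in D1) \int[m2]_(y in D2) (h y * K (x, y)) <=
  C%:E * \int[m2]_(y in D2) h y.
Proof.
move=> KC; pose f z := h z.2 * K z.
have mf : measurable_fun setT f.
  by apply: emeasurable_funM => //; exact: measurableT_comp.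
have f0 z : 0 <= f z by rewrite mule_ge0.
rewrite (fubini_tonelli_in mD1 mD2 m1D1 m2D2 f0 mf)/f/=.
(* The sign of [C] is read off from the kernel bound at a point of [D2]; if there is none, both
   sides vanish. *)
have [D2E|/set0P[y0 D2y0]] := eqVneq D2 set0.
  by rewrite D2E !integral_set0 mule0.
have C0 : (0 <= C)%R.
  by rewrite -lee_fin; apply: le_trans (KC _ D2y0); exact: integral_ge0.
rewrite -ge0_integralZl//; last exact: measurable_funTS.
apply: ge0_subset_le_integral => // y D2y.
  by apply: integral_ge0 => x _; exact: f0 (x, y).
have mKy : measurable_fun D1 (fun x => K (x, y)).
  by apply: measurable_funTS; exact: (measurableT_comp mK (pair2_measurable y)).
rewrite (ge0_integralZl m1 mD1 mKy)//.
by rewrite muleC lee_wpmul2r// KC.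
Qed.

End schur.

(** * Dyadic Riesz kernels *)

Section geometric_sums.
Context {R : realType}.

Lemma nneseries_geometric_le (u : nat -> \bar R) (c q : R) :
  0 <= c -> 0 < q < 1 -> (forall k, 0 <= u k)%E ->
  (forall k, u k <= (c * q ^+ k)%:E)%E ->
  (\sum_(k <oo) u k <= (c / (1 - q))%:E)%E.
Proof.
move=> c0 /andP[q0 q1] u0 uq; apply: lime_le; first exact: is_cvg_nneseries.
near=> N; apply: (@le_trans _ _ (\sum_(0 <= k < N) (c * q ^+ k)%:E)%E).
  exact: lee_sum.
rewrite sumEFin lee_fin; apply: geometric_le_lim => //.
by rewrite ger0_norm// ltW.
Unshelve. all: by end_near. Qed.

Lemma geometric_increments (a : R^nat) (K q : R) : 0 <= K -> 0 < q < 1 ->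
  (forall k, `|a k.+1 - a k| <= K * q ^+ k) ->
  cvgn a /\ forall k, `|limn a - a k| <= K * q ^+ k / (1 - q).
Proof.
move=> K0 /andP[q0 q1] aq.
have q1' : 0 < 1 - q by rewrite subr_gt0.
have cva : cvgn a.
  rewrite (_ : a = (fun k => a 0%N + series (telescope a) k)); last first.
    by apply/funext => k; exact: eq_sum_telescope.
  apply: is_cvgD; first exact: is_cvg_cst.
  apply: (@normed_cvg R R^o).
  apply: (@series_le_cvg _ _ (geometric K q)).
  - by move=> k; exact: normr_ge0.
  - by move=> k; apply: mulr_ge0 => //; rewrite exprn_ge0// ltW.
  - exact: aq.
  - by apply: is_cvg_geometric_series; rewrite ger0_norm// ltW.
split=> // k.
(* Keeping the factor [1 - q ^+ j] makes the induction close by an identity; the bound without it is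
   not inductive. *)
have step j : `|a (j + k)%N - a k| <= K * q ^+ k * (1 - q ^+ j) / (1 - q).
  elim: j => [|j IH]; first by rewrite add0n !subrr normr0 mulr0 mul0r.
  rewrite addSn -(subrK (a (j + k)%N) (a (j + k).+1)) -addrA.
  apply: le_trans (ler_normD _ _) _; apply: le_trans (lerD (aq _) IH) _.
  rewrite exprD exprS le_eqVlt; apply/orP; left; apply/eqP; field.
  by rewrite subr_eq0 eq_sym lt_eqF.
have cvn : `|a m - a k| @[m --> \oo] --> `|limn a - a k|.
  by apply: cvg_norm; apply: cvgB => //; exact: cvg_cst.
apply: (cvgr_to_le cvn); near=> m.
rewrite -(@subnK k m); last by near: m; exact: nbhs_infty_ge.
apply: le_trans (step _) _; rewrite ler_pM2r ?invr_gt0//.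
rewrite ler_piMr ?mulr_ge0 ?exprn_ge0 ?(ltW q0)//.
by rewrite gerBl exprn_ge0// ltW.
Unshelve. all: by end_near. Qed.

End geometric_sums.

Section dyadic_radii.
Context {R : realType}.

(* The radii start at 2 = [dyadic 0] so that any distance up to 1 is at most
   [dyadic k.+1] for some k, leaving room for the larger radius [dyadic k]. *)
Definition dyadic (k : nat) : R := 2 * 2^-1 ^+ k.

Lemma dyadic_gt0 k : 0 < dyadic k.
Proof. by rewrite mulr_gt0// exprn_gt0// invr_gt0. Qed.

Lemma dyadicS k : dyadic k.+1 = dyadic k / 2.
Proof. by rewrite /dyadic exprS; ring. Qed.

Lemma dyadic_le2 k : dyadic k <= 2.
Proof.
rewrite /dyadic ler_piMr// exprn_ile1// ?invr_ge0//.
by rewrite invf_le1// ler1n.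
Qed.

Lemma dyadic_powR k (e : R) :
  dyadic k `^ e = 2 `^ e * ((2^-1 : R) `^ e) ^+ k.
Proof.
rewrite /dyadic powRM ?exprn_ge0 ?invr_ge0//; congr (_ * _).
by rewrite -!powR_mulrn ?invr_ge0 ?powR_ge0// powRAC.
Qed.

Lemma half_powR (e : R) : 0 < e -> 0 < (2^-1 : R) `^ e < 1.
Proof.
move=> e0; rewrite powR_gt0 ?invr_gt0//=.
have : (2^-1 : R) `^ e < 1 `^ e.
  by apply: gt0_ltr_powR => //; rewrite ?nnegrE ?invr_ge0// invf_lt1// ltr1n.
by rewrite powR1.
Qed.

Lemma dyadic_cvg0 : dyadic k @[k --> \oo] --> (0 : R).
Proof.
have h : `|2^-1 : R| < 1.
  by rewrite ger0_norm ?invr_ge0// invf_lt1// ltr1n.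
have := cvgM (cvg_cst (2 : R)) (cvg_expr h); rewrite mulr0; exact.
Qed.

Lemma dyadic_scale (d : R) : 0 < d <= 1 ->
  exists k, dyadic k.+2 < d <= dyadic k.+1.
Proof.
move=> /andP[d0 d1].
have ex : exists k, dyadic k < d.
  have [N _ /(_ N (leqnn N))] := cvgr_lt 0 dyadic_cvg0 _ d0.
  by exists N.
(* Indices 0 and 1 are impossible since their radii 2 and 1 are at least [d]; for the others
   minimality gives the upper bound. *)
case: (ex_minnP ex) => m md mmin; case: m md mmin => [|[|k]] md mmin.
- by have := lt_le_trans md d1; rewrite /dyadic expr0 mulr1 ltrn1.
- by have := lt_le_trans md d1; rewrite /dyadic expr1 mulfV ?ltxx// pnatr_eq0.
- by exists k; rewrite md leNgt; apply/negP => /mmin; rewrite ltnn.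
Qed.

End dyadic_radii.

Section dyadic_kernel.
Context {R : realType} {n : nat}.
Implicit Types (x y : 'rV[R]_n) (s : R).

(* A dyadic version of the Riesz kernel [d(x,y)^(-s)], finite off the diagonal. *)
Definition riesz (s : R) (z : 'rV[R]_n * 'rV[R]_n) : \bar R :=
  (\sum_(k <oo)
    (dyadic k `^ (- s) * \1_[set z | (edist z.1 z.2 < dyadic k)%R] z)%:E)%E.

Let term_ge0 s (z : 'rV[R]_n * 'rV[R]_n) k :
  (0 <= (dyadic k `^ (- s) *
         \1_[set z | (edist z.1 z.2 < dyadic k)%R] z)%:E)%E.
Proof. by rewrite lee_fin mulr_ge0// powR_ge0. Qed.

Let indic_eball (x y : 'rV[R]_n) (r : R) :
  \1_[set z : 'rV[R]_n * 'rV[R]_n | edist z.1 z.2 < r] (x, y) =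
  \1_(eball y r) x :> R.
Proof.
rewrite !indicE; congr (nat_of_bool _)%:R.
by apply/idP/idP => /set_mem h; apply/mem_set; move: h; rewrite /eball/= edistC.
Qed.

Lemma riesz_ge0 s z : (0 <= riesz s z)%E.
Proof. by apply: nneseries_ge0 => k _ _; exact: term_ge0. Qed.

Lemma measurable_riesz s : measurable_fun setT (riesz s).
Proof.
apply: ge0_emeasurable_sum => [k z _ _|k _]; first exact: term_ge0.
apply/measurable_EFinP; apply: measurable_funM => //.
by apply: measurable_indic; exact: measurable_eball_pair.
Qed.

Lemma rieszC s x y : riesz s (x, y) = riesz s (y, x).
Proof.
apply: eq_eseriesr => k _; rewrite !indic_eball !indicE.
congr (_ * (nat_of_bool _)%:R)%:E.
by apply/idP/idP => /set_mem h; apply/mem_set; move: h; rewrite /eball/= edistC.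
Qed.

(** One term of the series suffices, whatever the sign of [s]. *)
Lemma riesz_ge s x y k : edist x y < dyadic k ->
  ((dyadic k `^ (- s))%:E <= riesz s (x, y))%E.
Proof.
move=> xy; apply: le_trans (nneseries_lim_ge k.+1 _) => /=; last first.
  by move=> *; exact: term_ge0.
rewrite big_nat_recr//= indicE mem_set//= mulr1 leeDr//.
by apply: sume_ge0 => i _; exact: term_ge0.
Qed.

(** With [r = dyadic k], the term of index [k] integrates to at most [C r^(Q - s)], so [s < Q] gives
    a geometric series of ratio [2^-(Q - s)]. *)
Lemma integral_riesz_le (m : {measure set 'rV[R]_n -> \bar R})
    (E : set 'rV[R]_n) (Q s C : R) :
  measurable E -> s < Q -> 0 <= C ->
  (forall y r, 0 < r -> (m (E `&` eball y r) <= (C * r `^ Q)%:E)%E) ->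
  exists2 C' : R, 0 <= C' &
    forall y, (\int[m]_(x in E) riesz s (x, y) <= C'%:E)%E.
Proof.
move=> mE sQ C0 mC; have eta0 : 0 < Q - s by rewrite subr_gt0.
have /andP[q0 q1] := half_powR eta0.
exists (C * 2 `^ (Q - s) / (1 - 2^-1 `^ (Q - s))) => [|y].
  by rewrite divr_ge0 ?mulr_ge0 ?powR_ge0// subr_ge0 ltW.
have mk k : measurable_fun E (fun x => (dyadic k `^ (- s) *
    \1_[set z : 'rV[R]_n * 'rV[R]_n | (edist z.1 z.2 < dyadic k)%R] (x, y))%:E).
  apply: measurable_funTS; apply/measurable_EFinP; apply: measurable_funM => //.
  apply: (measurableT_comp _ (pair2_measurable y)).
  by apply: measurable_indic; exact: measurable_eball_pair.
rewrite /riesz (integral_nneseries m mE mk); last first.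
  by move=> k x _; exact: (term_ge0 s (x, y) k).
apply: nneseries_geometric_le.
- by rewrite mulr_ge0// powR_ge0.
- by rewrite q0.
- by move=> k; apply: integral_ge0 => x _; exact: (term_ge0 s (x, y) k).
- move=> k; under eq_integral do rewrite EFinM.
  rewrite ge0_integralZl_EFin ?powR_ge0//; last first.
    apply: measurable_funTS; apply/measurable_EFinP.
    apply: (measurableT_comp _ (pair2_measurable y)).
    by apply: measurable_indic; exact: measurable_eball_pair.
  rewrite (_ : (fun x => _) = (fun x => (\1_(eball y (dyadic k)) x)%:E)); last first.
    by apply/funext => x; rewrite indic_eball.
  rewrite integral_indic//; last exact: measurable_eball.
  rewrite setIC; apply: (@le_trans _ _ ((dyadic k `^ (- s))%:E *
      (C * dyadic k `^ Q)%:E)%E).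
    by rewrite lee_wpmul2l ?lee_fin ?powR_ge0// mC// dyadic_gt0.
  have d0 : (dyadic k : R) != 0 by rewrite gt_eqF// dyadic_gt0.
  rewrite -EFinM lee_fin mulrCA -powRD ?d0 ?implybT//.
  by rewrite addrC dyadic_powR mulrA.
Qed.

End dyadic_kernel.

(** * Averages *)

Section averages.
Context {R : realType} {n : nat} (mu : {measure set 'rV[R]_n -> \bar R}).
Implicit Types (B D : set 'rV[R]_n) (f h : 'rV[R]_n -> R).

Lemma Lnorm_patch B f p : 0 < p ->
  'N[mu]_p%:E[EFin \o (f \_ B)]%E =
  ((\int[mu]_(x in B) (`|f x| `^ p)%:E) `^ p^-1)%E.
Proof.
move=> p0; rewrite unlock [in RHS]integral_mkcond; congr (_ `^ _)%E.
apply: eq_integral => x _; rewrite /= !patchE; case: ifPn => //= _.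
by rewrite normr0 powR0// gt_eqF.
Qed.

(** Hölder's inequality against the indicator of [B], whose norm in the conjugate exponent is
    [mu(B)^(1 - 1/p)]. *)
Lemma Lfun_integral_le B f p : measurable B -> (mu B < +oo)%E -> 1 < p ->
  f \_ B \in Lfun mu p%:E ->
  (\int[mu]_(x in B) `|f x|%:E <=
   'N[mu]_p%:E[EFin \o (f \_ B)] * (fine (mu B) `^ (1 - p^-1))%:E)%E.
Proof.
move=> mB Boo p1 /andP[/[!inE]/= mf _].
have p0 : 0 < p by rewrite (lt_trans ltr01).
pose q := (1 - p^-1)^-1.
have q0 : 0 < q by rewrite invr_gt0 subr_gt0 invf_lt1.
have pq : p^-1 + q^-1 = 1 by rewrite invrK; ring.
have mB1 : measurable_fun setT (\1_B : 'rV[R]_n -> R) by exact: measurable_indic.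
have := hoelder mu mf mB1 p0 q0 pq.
rewrite unlock invr1 poweRe1; last by apply: integral_ge0 => x _; exact: poweR_ge0.
rewrite (_ : (\int[mu]_x _)%E = (\int[mu]_(x in B) `|f x|%:E)%E); last first.
  rewrite [RHS]integral_mkcond; apply: eq_integral => x _ /=.
  rewrite powRr1// patchE indicE patchE; case: ifPn => _.
    by rewrite mulr1.
  by rewrite mulr0 normr0.
move=> /le_trans; apply; apply: lee_wpmul2l; first exact: poweR_ge0.
rewrite invrK (_ : (\int[mu]_x _)%E = mu B).
  by rewrite -[in leLHS](@fineK _ (mu B)) ?ge0_fin_numE// poweR_EFin.
rewrite -[RHS]mul1e -integral_cst// [RHS]integral_mkcond.
apply: eq_integral => x _ /=; rewrite indicE patchE; case: ifPn => _.
  by rewrite normr1 powR1.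
by rewrite normr0 powR0// gt_eqF.
Qed.

Lemma Lfun_measurable_in B f p : measurable B -> f \_ B \in Lfun mu p%:E ->
  measurable_fun B f.
Proof.
move=> mB /andP[/[!inE]/= mf _].
by move: mf => /(measurable_restrict f mB measurableT); rewrite setTI.
Qed.

Lemma Lfun_norm_fin B f p : f \_ B \in Lfun mu p%:E ->
  'N[mu]_p%:E[EFin \o (f \_ B)]%E \is a fin_num.
Proof.
by move=> /andP[_ /[!inE]/=]; rewrite ge0_fin_numE// Lnorm_ge0.
Qed.

Lemma Lfun_integrable_in B f p : measurable B -> (mu B < +oo)%E -> 1 < p ->
  f \_ B \in Lfun mu p%:E -> mu.-integrable B (EFin \o f).
Proof.
move=> mB Boo p1 fp; apply/integrableP; split.
  by apply/measurable_EFinP; exact: Lfun_measurable_in fp.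
apply: le_lt_trans (Lfun_integral_le mB Boo p1 fp) _.
by rewrite -(fineK (Lfun_norm_fin fp)) -EFinM ltry.
Qed.

(** The left side is the modulus of the mean of [f - A] over [D']; enlarging the domain of [|f - A|]
    to [D] costs the ratio of the masses. This is how an oscillation bound on one ball compares two
    averages. *)
Lemma average_sub_le D D' f : measurable D -> measurable D' -> D' `<=` D ->
  (mu D < +oo)%E -> (0 < mu D')%E -> mu.-integrable D (EFin \o f) ->
  `|average mu D' f - average mu D f| <=
  fine (mu D) / fine (mu D') *
    average mu D (fun x => `|f x - average mu D f|).
Proof.
move=> mD mD' D'D Doo D'0 fD; set A := average mu D f.
have D'oo : (mu D' < +oo)%E.
  by apply: le_lt_trans Doo; apply: le_measure; rewrite ?inE.
have fD' := integrableS mD mD' D'D fD.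
have m'0 : 0 < fine (mu D') by rewrite fine_gt0// D'0.
have m0 : 0 < fine (mu D).
  rewrite fine_gt0// Doo andbT (lt_le_trans D'0)//.
  by apply: le_measure; rewrite ?inE.
have icst (F : set 'rV[R]_n) : measurable F -> (mu F < +oo)%E ->
    mu.-integrable F (EFin \o (cst A)).
  move=> mF Foo; apply/integrableP; split.
    by apply/measurable_EFinP; exact: measurable_cst.
  by rewrite (integral_cst mu mF `|A|%:E) lte_mul_pinfty.
have -> : average mu D' f - A = (fine (mu D'))^-1 * \int[mu]_(x in D') (f x - A).
  rewrite RintegralB// ?Rintegral_cst//; last exact: icst.
  by rewrite /average mulrBr mulrCA mulVf ?gt_eqF// mulr1.
rewrite normrM gtr0_norm ?invr_gt0// /average mulrA.
rewrite (mulrC (fine (mu D))) -(mulrA _ (fine (mu D))) mulfV ?gt_eqF// mulr1.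
rewrite ler_pM2l ?invr_gt0//.
have iB : mu.-integrable D (EFin \o (fun x => f x - A)).
  have := integrableB mD fD (icst D mD Doo); congr (_.-integrable _ _).
apply: le_trans (le_normr_Rintegral mD' (integrableS mD mD' D'D iB)) _.
have miB : measurable_fun D (EFin \o (fun x => `|f x - A|)).
  have /integrableP[/measurable_EFinP h _] := iB.
  by apply/measurable_EFinP; exact: measurableT_comp.
apply: fine_le.
- have := integrable_fin_num mD' (integrable_norm (integrableS mD mD' D'D iB)).
  exact.
- have := integrable_fin_num mD (integrable_norm iB).
  exact.
- by apply: ge0_subset_integral => // x _; rewrite lee_fin.
Qed.

End averages.

(** * The trace and its pointwise bounds *)

Section trace_operator.
Context {R : realType} {n : nat} (mu : {measure set 'rV[R]_n -> \bar R}).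
Variable B : set 'rV[R]_n.
Implicit Types (f h : 'rV[R]_n -> R) (x y : 'rV[R]_n).

Definition trace_ball x k : set 'rV[R]_n := eball x (dyadic k) `&` B.

(* The limit superior makes [trace f] measurable without further argument; it is
   the limit of the averages wherever that limit exists. *)
Definition trace f x : R :=
  fine (limn_esup (fun k => (average mu (trace_ball x k) f)%:E)).

Lemma trace_cvg f x l :
  average mu (trace_ball x k) f @[k --> \oo] --> l -> trace f x = l.
Proof.
move=> fl; rewrite /trace.
suff /cvg_limn_einf_sup[_ ->] :
  (average mu (trace_ball x k) f)%:E @[k --> \oo] --> l%:E by [].
by apply/fine_cvgP; split; [exact: nearW|exact: fl].
Qed.

(** The function [M] of the overview for a general density [h], later [|grad f|^p]. *)
Definition potential (s : R) h x : \bar R :=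
  (\int[mu]_(z in B) ((h z)%:E * riesz s (x, z)))%E.

Lemma measurable_trace_ball x k : measurable B -> measurable (trace_ball x k).
Proof. by move=> mB; apply: measurableI => //; exact: measurable_eball. Qed.

Hypotheses (mB : measurable B) (Boo : (mu B < +oo)%E).

Lemma measurable_potential s h : (forall z, 0 <= h z) ->
  measurable_fun setT h -> measurable_fun setT (potential s h).
Proof.
move=> h0 mh; apply: (@measurable_fun_integral_in _ _ _ _ _ mu B mB Boo
  (fun xz => (h xz.2)%:E * riesz s xz)%E).
  by move=> z; rewrite mule_ge0 ?riesz_ge0// lee_fin.
apply: emeasurable_funM; last exact: measurable_riesz.
by apply/measurable_EFinP; exact: measurableT_comp.
Qed.

(** The domain of integration moves with [x]. Its indicator is that of a measurable set of pairs,
    which gives an integral over the fixed set [B] with a jointly measurable integrand. *)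
Let measurable_ball_integral (phi : 'rV[R]_n -> \bar R) k :
  (forall z, 0 <= phi z)%E -> measurable_fun B phi ->
  measurable_fun setT (fun x => \int[mu]_(z in trace_ball x k) phi z)%E.
Proof.
move=> phi0 mphi.
have mphiB : measurable_fun setT (phi \_ B).
  by apply/(measurable_restrict _ mB measurableT); rewrite setTI.
pose S := [set xz : 'rV[R]_n * 'rV[R]_n | edist xz.1 xz.2 < dyadic k].
have := @measurable_fun_integral_in _ _ _ _ _ mu B mB Boo
  (fun xz => (phi \_ B) xz.2 * (\1_S xz)%:E)%E.
have -> : (fun x => \int[mu]_(z in trace_ball x k) phi z)%E =
    (fun x => \int[mu]_(z in B) ((phi \_ B) z * (\1_S (x, z))%:E))%E.
  apply/funext => x; rewrite /trace_ball setIC integral_mkcondr.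
  apply: eq_integral => z zB; rewrite patchE [(phi \_ B) z]patchE zB indicE.
  rewrite (_ : ((x, z) \in S) = (z \in eball x (dyadic k))); last first.
    by apply/idP/idP => /set_mem h; exact/mem_set.
  by case: ifPn; rewrite ?mule1 ?mule0.
apply.
- move=> z; rewrite mule_ge0// ?lee_fin//; exact: erestrict_ge0.
- apply: emeasurable_funM; first exact: measurableT_comp.
  apply/measurable_EFinP; apply: measurable_indic.
  exact: measurable_eball_pair.
Qed.

Lemma measurable_trace f : measurable_fun B f -> measurable_fun setT (trace f).
Proof.
move=> mf; apply: (measurableT_comp (fine_measurable measurableT)).
apply: measurable_fun_limn_esup => k; apply/measurable_EFinP.
apply: measurable_funM.
  (* The inverse becomes a power so that [measurable_powR] applies, and the mass becomes the
     integral of 1 so that [measurable_ball_integral] does. *)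
  rewrite (_ : (fun x => _) =
    (fun x => fine (\int[mu]_(z in trace_ball x k) 1)%E `^ (- 1))).
    apply: (measurableT_comp (@measurable_powR R (- 1))).
    apply: (measurableT_comp (fine_measurable measurableT)).
    by apply: measurable_ball_integral => //; exact: measurable_cst.
  apply/funext => x; rewrite integral_cst ?mul1e ?powR_inv1 ?fine_ge0//.
  exact: measurable_trace_ball.
apply: (measurableT_comp (fine_measurable measurableT)).
rewrite (_ : (fun x => _) = (fun x =>
  (\int[mu]_(z in trace_ball x k) (EFin \o f)^\+ z) -
  (\int[mu]_(z in trace_ball x k) (EFin \o f)^\- z))%E); last first.
  by apply/funext => x; rewrite integralE.
apply: emeasurable_funB; apply: measurable_ball_integral => //.
  by apply: measurable_funepos; exact/measurable_EFinP.
by apply: measurable_funeneg; exact/measurable_EFinP.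
Qed.

End trace_operator.

Section pointwise_bounds.
Context {R : realType} {n : nat} (mu : {measure set 'rV[R]_n -> \bar R}).
Variables (B E : set 'rV[R]_n) (p a s c Cu CP : R) (f h : 'rV[R]_n -> R).
Hypotheses (mB : measurable B) (Boo : (mu B < +oo)%E).
Hypotheses (p1 : 1 < p) (c0 : 0 < c) (Cu0 : 0 < Cu) (CP0 : 0 < CP).
Hypothesis lower : forall x k, E x ->
  ((c * dyadic k `^ a)%:E <= mu (trace_ball B x k))%E.
Hypothesis upper : forall x k, E x ->
  (mu (trace_ball B x k) <= (Cu * dyadic k `^ a)%:E)%E.
Hypotheses (fB : mu.-integrable B (EFin \o f)).
Hypotheses (h0 : forall z, 0 <= h z) (mh : measurable_fun setT h).
Hypothesis hB : mu.-integrable B (EFin \o h).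
Hypothesis poincare : forall x k, E x -> let D := trace_ball B x k in
  average mu D (fun z => `|f z - average mu D f|) <=
  CP * dyadic k * average mu D h `^ p^-1.

Local Notation D := (trace_ball B).
Local Notation M := (potential mu B s h).
Local Notation A x k := (average mu (D x k) f).

Let p0 : 0 < p. Proof. exact: lt_trans p1. Qed.

Let Doo x k : (mu (D x k) < +oo)%E.
Proof.
apply: le_lt_trans Boo; apply: le_measure; rewrite ?inE//.
  exact: measurable_trace_ball.
exact: subIsetr.
Qed.

Let mD x k : measurable (D x k). Proof. exact: measurable_trace_ball. Qed.

Let DB x k : D x k `<=` B. Proof. exact: subIsetr. Qed.

Let r0 k : 0 < (dyadic k : R). Proof. exact: dyadic_gt0. Qed.

Let mu_lower x k : E x -> c * dyadic k `^ a <= fine (mu (D x k)).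
Proof. by move=> Ex; rewrite -lee_fin fineK ?ge0_fin_numE// lower. Qed.

Let mu_upper x k : E x -> fine (mu (D x k)) <= Cu * dyadic k `^ a.
Proof. by move=> Ex; rewrite -lee_fin fineK ?ge0_fin_numE// upper. Qed.

Let potential_ge0 x : (0 <= M x)%E.
Proof. by apply: integral_ge0 => z _; rewrite mule_ge0 ?riesz_ge0// lee_fin. Qed.

(** The kernel is at least [r^(-s)] on the ball of radius [r] about [x]. Thus the local integral in
    the Poincare inequality is traded for a number depending on the center alone, with a gain
    [r^s]. *)
Let integral_le_potential x k m : M x = m%:E ->
  \int[mu]_(z in D x k) h z <= dyadic k `^ s * m.
Proof.
move=> Mm; have hD := integrableS mB (mD x k) (@DB x k) hB.
have rs0 : 0 < (dyadic k : R) `^ s by rewrite powR_gt0.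
rewrite mulrC -ler_pdivrMr// -lee_fin -Mm EFinM fineK; last first.
  exact: integral_fune_fin_num.
rewrite muleC -powRN -ge0_integralZl_EFin//; last 3 first.
- by move=> z _; rewrite lee_fin.
- by apply/measurable_EFinP; exact: measurable_funTS.
- exact: powR_ge0.
have mhK : measurable_fun B (fun z => (h z)%:E * riesz s (x, z))%E.
  apply: measurable_funTS; apply: emeasurable_funM; first exact/measurable_EFinP.
  exact: (measurableT_comp (measurable_riesz s) (pair1_measurable x)).
have hK0 z : B z -> (0 <= (h z)%:E * riesz s (x, z))%E.
  by move=> _; rewrite mule_ge0 ?riesz_ge0// lee_fin.
apply: le_trans (ge0_subset_integral mu (mD x k) mB mhK hK0 (@DB x k)).
apply: ge0_subset_le_integral => [z _|z [Dz _]].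
  by rewrite mule_ge0// lee_fin// powR_ge0.
by rewrite muleC lee_wpmul2l// ?lee_fin//; exact: riesz_ge.
Qed.

Let t := 1 + (s - a) / p.

(** Poincare and [integral_le_potential] give [r (r^(-a) r^s m)^(1/p) = r^t m^(1/p)]. Leaving [D']
    free, subject to a mass bound, allows both a smaller radius and a new center. *)
Let average_near x k D' c' m : E x -> M x = m%:E -> 0 < c' ->
  measurable D' -> D' `<=` D x k -> ((c' * dyadic k `^ a)%:E <= mu D')%E ->
  `|average mu D' f - A x k| <=
  Cu / c' * (CP * c `^ (- p^-1)) * (dyadic k `^ t * m `^ p^-1).
Proof.
move=> Ex Mm c'0 mD' D'D D'c'; set r := dyadic k : R.
have ra0 : 0 < r `^ a by rewrite powR_gt0// /r.
have rN0 b : b ==> (r != 0) by rewrite (gt_eqF (r0 k)) implybT.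
have D'0 : (0 < mu D')%E.
  by apply: lt_le_trans D'c'; rewrite lte_fin mulr_gt0.
have D'oo : (mu D' < +oo)%E.
  by apply: le_lt_trans (Doo x k); apply: le_measure; rewrite ?inE.
have m'c' : c' * r `^ a <= fine (mu D') by rewrite -lee_fin fineK ?ge0_fin_numE.
have fD := integrableS mB (mD x k) (@DB x k) fB.
apply: le_trans (average_sub_le (mD x k) mD' D'D (Doo x k) D'0 fD) _.
have m0 : 0 <= m by rewrite -lee_fin -Mm.
have hD0 : 0 <= \int[mu]_(z in D x k) h z by apply: Rintegral_ge0.
have ratio : fine (mu (D x k)) / fine (mu D') <= Cu / c'.
  rewrite ler_pdivrMr; last by apply: lt_le_trans m'c'; rewrite mulr_gt0.
  apply: le_trans (mu_upper k Ex) _.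
  rewrite (_ : Cu * _ = Cu / c' * (c' * r `^ a)); last first.
    by field; rewrite gt_eqF.
  by rewrite ler_pM2l// divr_gt0.
have avh : average mu (D x k) h <= c^-1 * (r `^ (s - a) * m).
  rewrite powRB ?rN0// (_ : c^-1 * _ = (c * r `^ a)^-1 * (r `^ s * m)); last first.
    by field; rewrite !gt_eqF.
  rewrite /average; apply: ler_pM => //.
    rewrite lef_pV2 ?posrE ?mu_lower//; last by rewrite mulr_gt0.
    by apply: lt_le_trans (mu_lower k Ex); rewrite mulr_gt0.
  exact: integral_le_potential.
have avh_powR : average mu (D x k) h `^ p^-1 <=
    c `^ (- p^-1) * (r `^ ((s - a) / p) * m `^ p^-1).
  apply: (@le_trans _ _ ((c^-1 * (r `^ (s - a) * m)) `^ p^-1)).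
    apply: ge0_ler_powR; rewrite ?nnegrE ?invr_ge0 ?(ltW p0)//.
      by rewrite /average mulr_ge0// invr_ge0 fine_ge0.
    by rewrite !mulr_ge0 ?powR_ge0// invr_ge0 ltW.
  rewrite powRM ?mulr_ge0 ?powR_ge0 ?invr_ge0 ?(ltW c0)//.
  rewrite powRM ?powR_ge0// -powR_inv1 ?(ltW c0)// -!powRrM mulN1r.
  by rewrite lexx.
have -> : Cu / c' * (CP * c `^ (- p^-1)) * (r `^ t * m `^ p^-1) =
    Cu / c' * (CP * r * (c `^ (- p^-1) * (r `^ ((s - a) / p) * m `^ p^-1))).
  by rewrite /t powRD ?rN0// powRr1 ?(ltW (r0 k))//; ring.
apply: ler_pM; [| |exact: ratio|].
- by rewrite divr_ge0// fine_ge0.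
- rewrite /average mulr_ge0 ?invr_ge0 ?fine_ge0//.
  by apply: integral_ge0 => z _; rewrite lee_fin.
- apply: le_trans (poincare k Ex) _; rewrite ler_pM2l//.
  by rewrite mulr_gt0// r0.
Qed.

Hypothesis t0 : 0 < t.

Let q : R := 2^-1 `^ t.
(** The constant of [average_near] for a ball of the next smaller scale: [c * 2^-1 ^ a] is its lower
    mass constant relative to [dyadic k]. *)
Let C1 := Cu / (c * 2^-1 `^ a) * (CP * c `^ (- p^-1)).

Let q01 : 0 < q < 1. Proof. exact: half_powR. Qed.

Let C10 : 0 < C1.
Proof.
by rewrite /C1 !mulr_gt0 ?invr_gt0 ?powR_gt0 ?mulr_gt0 ?powR_gt0 ?invr_gt0.
Qed.

Let dyadicS_powR k (e : R) : dyadic k.+1 `^ e = (2^-1) `^ e * dyadic k `^ e.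
Proof. by rewrite dyadicS mulrC powRM ?invr_ge0// ltW. Qed.

(** Used with [y = x] for telescoping and with [y != x] for the passage between centers; only [M] at
    the center of the larger ball enters. *)
Let average_step x y k m : E x -> E y -> M x = m%:E ->
  eball y (dyadic k.+1) `<=` eball x (dyadic k) ->
  `|A y k.+1 - A x k| <= C1 * (dyadic k `^ t * m `^ p^-1).
Proof.
move=> Ex Ey Mm yx; apply: average_near => //.
- by rewrite mulr_gt0// powR_gt0 ?invr_gt0.
- exact: setSI.
- by rewrite -mulrA -dyadicS_powR; exact: lower.
Qed.

Let C2 := C1 / (1 - q).

Let C2_gt0 : 0 < C2.
Proof. by case/andP: q01 => _ q1; rewrite divr_gt0// subr_gt0. Qed.

Lemma trace_rate x m : E x -> M x = m%:E ->
  A x k @[k --> \oo] --> trace mu B f x /\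
  forall k, `|trace mu B f x - A x k| <= C2 * (dyadic k `^ t * m `^ p^-1).
Proof.
move=> Ex Mm.
have [||k|cA rate] := @geometric_increments R (fun k => A x k)
    (C1 * 2 `^ t * m `^ p^-1) q.
- by rewrite mulr_ge0 ?powR_ge0// mulr_ge0 ?powR_ge0// ltW.
- exact: q01.
- apply: le_trans (average_step Ex Ex Mm _) _.
    by apply: eball_le; rewrite dyadicS ler_pdivrMr// ler_pMr// ler1n.
  by rewrite dyadic_powR -/q le_eqVlt; apply/orP; left; apply/eqP; ring.
have -> : trace mu B f x = limn (fun k => A x k) by exact: trace_cvg.
split=> // k; apply: le_trans (rate k) _.
by rewrite dyadic_powR -/q /C2 le_eqVlt; apply/orP; left; apply/eqP; ring.
Qed.

Let powR_add_le (u v : R) : 0 <= u -> 0 <= v ->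
  (u + v) `^ p <= 2 `^ p * (u `^ p + v `^ p).
Proof.
move=> u0 v0; rewrite mulrDr -!powRM//.
have [uv|vu] := leP u v.
  apply: ler_wpDl; first exact: powR_ge0.
  apply: ge0_ler_powR; rewrite ?nnegrE ?addr_ge0 ?mulr_ge0//; first exact: ltW.
  by rewrite mulr2n mulrDl mul1r lerD2r.
apply: ler_wpDr; first exact: powR_ge0.
apply: ge0_ler_powR; rewrite ?nnegrE ?addr_ge0 ?mulr_ge0//; first exact: ltW.
by rewrite mulr2n mulrDl mul1r lerD2l ltW.
Qed.

Let powRVK (m : R) : 0 <= m -> (m `^ p^-1) `^ p = m.
Proof. by move=> m0; rewrite -powRrM mulVf ?gt_eqF// powRr1. Qed.

(** The chain runs through [u x], [A x k], [A y k.+1], [u y]. The smaller scale at [y] makes its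
    ball fit into the one at [x], because [edist x y + dyadic k.+1 <= dyadic k]. *)
Lemma trace_difference x y k mx my : E x -> E y -> M x = mx%:E -> M y = my%:E ->
  edist x y <= dyadic k.+1 ->
  `|trace mu B f x - trace mu B f y| `^ p <=
  (2 * (C1 + C2)) `^ p * (dyadic k `^ (t * p) * (mx + my)).
Proof.
move=> Ex Ey Mx My xy; set u := trace mu B f.
have mx0 : 0 <= mx by rewrite -lee_fin -Mx.
have my0 : 0 <= my by rewrite -lee_fin -My.
have [_ /(_ k) ratex] := trace_rate Ex Mx.
have [_ /(_ k.+1) ratey] := trace_rate Ey My.
have step : `|A y k.+1 - A x k| <= C1 * (dyadic k `^ t * mx `^ p^-1).
  apply: average_step => //; apply: eball_sub.
  by rewrite (le_trans (lerD xy (lexx _)))// dyadicS -mulrDr; lra.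
have dk : dyadic k.+1 `^ t <= dyadic k `^ t :> R.
  rewrite dyadicS_powR ler_piMl ?powR_ge0//.
  by case/andP: q01 => _ /ltW.
have uxy : `|u x - u y| <=
    (C1 + C2) * (dyadic k `^ t * (mx `^ p^-1 + my `^ p^-1)).
  have split4 (u1 u2 a1 a2 : R) :
    u1 - u2 = (u1 - a1) - (a2 - a1) - (u2 - a2) by ring.
  rewrite (split4 _ _ (A x k) (A y k.+1)).
  apply: le_trans (ler_normB _ _) _.
  apply: le_trans (lerD (ler_normB _ _) (lexx _)) _.
  apply: le_trans (lerD (lerD ratex step) ratey) _.
  apply: (@le_trans _ _ (C2 * (dyadic k `^ t * mx `^ p^-1) +
    C1 * (dyadic k `^ t * mx `^ p^-1) + C2 * (dyadic k `^ t * my `^ p^-1))).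
    by rewrite lerD2l ler_pM2l// ler_wpM2r// powR_ge0.
  have regroup (b1 b2 r v w : R) : (b1 + b2) * (r * (v + w)) =
    b2 * (r * v) + b1 * (r * v) + b2 * (r * w) + b1 * (r * w) by ring.
  rewrite regroup lerDl; apply: mulr_ge0; first exact: ltW.
  by rewrite mulr_ge0 ?powR_ge0.
apply: (@le_trans _ _
    (((C1 + C2) * (dyadic k `^ t * (mx `^ p^-1 + my `^ p^-1))) `^ p)).
  apply: ge0_ler_powR; rewrite ?nnegrE//; first exact: ltW.
  exact: le_trans uxy.
have C12 : 0 <= C1 + C2 by rewrite addr_ge0// ltW.
have S0 : 0 <= mx `^ p^-1 + my `^ p^-1 by rewrite addr_ge0 ?powR_ge0.
have rS0 := mulr_ge0 (powR_ge0 (dyadic k) t) S0.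
rewrite (powRM p C12 rS0) (powRM p (powR_ge0 _ _) S0) -powRrM.
rewrite (powRM p (ler0n _ 2) C12) (mulrC (2 `^ p)) -mulrA.
rewrite ler_wpM2l ?powR_ge0// [leRHS]mulrCA ler_wpM2l ?powR_ge0//.
apply: le_trans (powR_add_le _ _) _; rewrite ?powR_ge0//.
by rewrite !powRVK.
Qed.

(** The trace is compared with the average at the largest scale, of radius [dyadic 0 = 2], which the
    L^1 norm of [f] and the lower mass bound control. *)
Lemma trace_size x m : E x -> M x = m%:E ->
  `|trace mu B f x| `^ p <=
  (2 * (C2 * dyadic 0 `^ t)) `^ p * m +
  (2 * (c * dyadic 0 `^ a)^-1) `^ p * (\int[mu]_(z in B) `|f z|) `^ p.
Proof.
move=> Ex Mm; set u := trace mu B f.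
have m0 : 0 <= m by rewrite -lee_fin -Mm.
have [_ /(_ 0%N) rate] := trace_rate Ex Mm.
have fD := integrableS mB (mD x 0) (@DB x 0) fB.
have I0 : 0 <= \int[mu]_(z in B) `|f z| by apply: Rintegral_ge0.
have ca0 : 0 < c * dyadic 0 `^ a by rewrite mulr_gt0// powR_gt0.
have A0 : `|A x 0%N| <= (c * dyadic 0 `^ a)^-1 * \int[mu]_(z in B) `|f z|.
  have m'0 := lt_le_trans ca0 (mu_lower 0 Ex).
  rewrite /average normrM gtr0_norm ?invr_gt0//.
  apply: ler_pM; rewrite ?invr_ge0 ?(ltW m'0)//.
    by rewrite lef_pV2 ?posrE// mu_lower.
  apply: le_trans (le_normr_Rintegral (mD x 0) fD) _.
  apply: fine_le.
  - by have := integrable_fin_num (mD x 0) (integrable_norm fD).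
  - by have := integrable_fin_num mB (integrable_norm fB).
  - apply: (ge0_subset_integral mu (mD x 0) mB _ _ (@DB x 0)) => [|z _].
      by have /integrableP[] := integrable_norm fB.
    by rewrite lee_fin.
apply: (@le_trans _ _ ((C2 * (dyadic 0 `^ t * m `^ p^-1) +
    (c * dyadic 0 `^ a)^-1 * \int[mu]_(z in B) `|f z|) `^ p)).
  apply: ge0_ler_powR; rewrite ?nnegrE//; first exact: ltW.
    by rewrite addr_ge0 ?(mulr_ge0 (ltW C2_gt0)) ?mulr_ge0 ?powR_ge0 ?invr_ge0 ?(ltW ca0).
  rewrite -(subrK (A x 0%N) (u x)); apply: le_trans (ler_normD _ _) _.
  exact: lerD.
have C2r : 0 <= C2 * dyadic 0 `^ t by rewrite mulr_ge0 ?powR_ge0 ?(ltW C2_gt0).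
have cI : 0 <= (c * dyadic 0 `^ a)^-1 by rewrite invr_ge0 ltW.
apply: le_trans (powR_add_le _ _) _.
- by rewrite (mulr_ge0 (ltW C2_gt0))// mulr_ge0 ?powR_ge0.
- by rewrite mulr_ge0.
rewrite mulrA (powRM p C2r (powR_ge0 _ _)) powRVK// (powRM p cI I0).
rewrite (powRM p (ler0n _ 2) C2r) (powRM p (ler0n _ 2) cI) mulrDr !mulrA.
exact: lexx.
Qed.

End pointwise_bounds.

(** * The Besov energy *)

Section besov_bound.
Context {R : realType} {n : nat} (nu : {measure set 'rV[R]_n -> \bar R}).
Variables (E : set 'rV[R]_n) (u : 'rV[R]_n -> R) (M : 'rV[R]_n -> \bar R).
Variables (p theta Q s e C cnu Ck : R).
Hypotheses (mE : measurable E) (Eoo : (nu E < +oo)%E).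
Hypotheses (p0 : 0 < p) (C0 : 0 < C) (cnu0 : 0 < cnu).
Hypothesis E1 : forall x y, E x -> E y -> edist x y <= 1.
Hypothesis lower : forall x y, E x -> E y -> x != y ->
  ((cnu * edist x y `^ Q)%:E <= nu (eball x (edist x y)))%E.
Hypotheses (theta0 : 0 <= theta) (Q0 : 0 <= Q).
Hypothesis es : e - theta * p - Q = - s.
Hypotheses (M0 : forall x, (0 <= M x)%E) (mM : measurable_fun setT M).
Hypothesis difference : forall x y k mx my, E x -> E y ->
  M x = mx%:E -> M y = my%:E -> edist x y <= dyadic k.+1 ->
  `|u x - u y| `^ p <= C * (dyadic k `^ e * (mx + my)).
Hypothesis kernel : forall y, (\int[nu]_(x in E) riesz s (x, y) <= Ck%:E)%E.

(** The distance is only known to be at least [dyadic k / 4], and it occurs in the denominator with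
    the exponents [theta * p] and [Q], the latter through the lower bound on [nu]. *)
Let Cb := C / cnu * 4 `^ (theta * p + Q).

Let Cb0 : 0 < Cb.
Proof. by rewrite !mulr_gt0 ?invr_gt0 ?powR_gt0. Qed.

Lemma besov_integrand_le x y : E x -> E y ->
  ((`|u y - u x| `^ p / edist x y `^ (theta * p))%:E
     * (nu (eball x (edist x y)))^-1 <=
   Cb%:E * (riesz s (x, y) * (M x + M y)))%E.
Proof.
move=> Ex Ey.
have K0 : (0 <= riesz s (x, y))%E by exact: riesz_ge0.
have rhs0 : (0 <= Cb%:E * (riesz s (x, y) * (M x + M y)))%E.
  apply: mule_ge0; first by rewrite lee_fin (ltW Cb0).
  by apply: mule_ge0 => //; exact: adde_ge0.
have [xy|xy] := eqVneq x y.
  by rewrite {1 2 3}xy subrr normr0 powR0 ?gt_eqF// mul0r mul0e.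
have d0 := edist_gt0 xy; set d := edist x y in d0 *.
have [k /andP[kd dk]] : exists k, dyadic k.+2 < d <= dyadic k.+1.
  by apply: dyadic_scale; rewrite d0 E1.
have r0 : 0 < (dyadic k : R) by exact: dyadic_gt0.
have Kge : ((dyadic k `^ (- s))%:E <= riesz s (x, y))%E.
  apply: riesz_ge; apply: le_lt_trans dk _.
  by rewrite dyadicS ltr_pdivrMr// ltr_pMr// ltr1n.
have K0' : (0 < riesz s (x, y))%E.
  by apply: lt_le_trans Kge; rewrite lte_fin powR_gt0.
(* The kernel is positive, so an infinite [M] makes the right side infinite and no null set has to
   be removed. *)
have [Moo|] := eqVneq (M x + M y)%E +oo%E.
  by rewrite Moo gt0_muley// gt0_muley ?leey// lte_fin.
rewrite -ltey => Mlt.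
have Mxf : M x \is a fin_num.
  by rewrite ge0_fin_numE//; apply: le_lt_trans Mlt; rewrite leeDl.
have Myf : M y \is a fin_num.
  by rewrite ge0_fin_numE//; apply: le_lt_trans Mlt; rewrite leeDr.
have := difference Ex Ey (esym (fineK Mxf)) (esym (fineK Myf)) dk.
set mx := fine (M x); set my := fine (M y) => uxy.
have m0 : 0 <= mx + my by rewrite addr_ge0 ?fine_ge0.
have dr : dyadic k / 4 <= d by move: kd; rewrite !dyadicS => kd; lra.
have r40 : 0 < dyadic k / 4 :> R by rewrite divr_gt0.
rewrite -(fineK Mxf) -(fineK Myf) -/mx -/my -EFinD.
apply: (@le_trans _ _ (Cb%:E * ((dyadic k `^ (- s))%:E * (mx + my)%:E))%E); last first.
  apply: lee_wpmul2l; first by rewrite lee_fin (ltW Cb0).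
  by apply: lee_wpmul2r; rewrite ?lee_fin.
have nuV : ((nu (eball x d))^-1 <= ((cnu * (dyadic k / 4) `^ Q)^-1)%:E)%E.
  have cd : 0 < cnu * (dyadic k / 4) `^ Q by rewrite mulr_gt0// powR_gt0.
  have -> : ((cnu * (dyadic k / 4) `^ Q)^-1)%:E =
    ((cnu * (dyadic k / 4) `^ Q)%:E)^-1%E by rewrite inver gt_eqF.
  rewrite lee_pV2 ?inE ?lee_fin ?(ltW cd)//.
  apply: le_trans (lower Ex Ey xy); rewrite lee_fin ler_pM2l//.
  by apply: ge0_ler_powR; rewrite ?nnegrE// ltW.
apply: le_trans (lee_pmul _ _ (lexx _) nuV) _.
- by rewrite lee_fin divr_ge0 ?powR_ge0.
- by rewrite inve_ge0.
rewrite -!EFinM lee_fin.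
apply: (@le_trans _ _ (C * (dyadic k `^ e * (mx + my)) /
    (dyadic k / 4) `^ (theta * p) * (cnu * (dyadic k / 4) `^ Q)^-1)).
  rewrite ler_wpM2r ?invr_ge0 ?mulr_ge0 ?powR_ge0 ?(ltW cnu0)//.
  apply: ler_pM; rewrite ?invr_ge0 ?powR_ge0//; first by rewrite distrC.
  rewrite lef_pV2 ?posrE ?powR_gt0//.
  by apply: ge0_ler_powR; rewrite ?nnegrE ?mulr_ge0 ?(ltW p0)// ltW.
have rN0 b : b ==> (dyadic k != 0 :> R) by rewrite (gt_eqF r0) implybT.
have q4 b : (dyadic k / 4) `^ b = dyadic k `^ b / 4 `^ b :> R.
  rewrite powRM ?invr_ge0 ?(ltW r0)// -[4^-1]powR_inv1// powRAC.
  by rewrite powR_inv1 ?powR_ge0.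
have rb b : dyadic k `^ b != 0 :> R by rewrite gt_eqF// powR_gt0.
have fb b : 4 `^ b != 0 :> R by rewrite gt_eqF// powR_gt0.
(* The powers of [dyadic k] combine to [e - theta p - Q = -s], and those of 4 to the factor in
   [Cb]. *)
rewrite -es /Cb !q4 !powRB ?rN0// powRD ?pnatr_eq0 ?implybT//.
rewrite le_eqVlt; apply/orP; left; apply/eqP; field.
by rewrite !rb !fb gt_eqF.
Qed.

(** The [M x] part uses the kernel bound in [y], by symmetry of [riesz]; the [M y] part is Schur's
    test with both measures equal to [nu]. Each contributes [Cb * Ck]. *)
Lemma besov_energy_le :
  (besov_energy nu E theta p u <=
   (2 * (Cb * Ck))%:E * \int[nu]_(x in E) M x)%E.
Proof.
have [E0|/set0P[x0 Ex0]] := eqVneq E set0.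
  by rewrite /besov_energy E0 !integral_set0 mule0.
have Ck0 : 0 <= Ck.
  rewrite -lee_fin; apply: le_trans (kernel x0).
  by apply: integral_ge0 => x _; exact: riesz_ge0.
have mKM : measurable_fun setT (fun z : 'rV[R]_n * 'rV[R]_n => M z.2 * riesz s z)%E.
  by apply: emeasurable_funM; [exact: measurableT_comp|exact: measurable_riesz].
have KM0 (z : 'rV[R]_n * 'rV[R]_n) : (0 <= M z.2 * riesz s z)%E.
  by rewrite mule_ge0// riesz_ge0.
pose G x := (\int[nu]_(y in E) (M y * riesz s (x, y)))%E.
have mG : measurable_fun setT G.
  exact: measurable_fun_integral_in mE Eoo _ KM0 mKM.
have G0 x : (0 <= G x)%E by apply: integral_ge0 => y _; exact: (KM0 (x, y)).
have GM : (\int[nu]_(x in E) G x <= Ck%:E * \int[nu]_(x in E) M x)%E.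
  apply: integral_kernel_le => //; first by move=> z; exact: riesz_ge0.
  exact: measurable_riesz.
have mK x : measurable_fun E (fun y => riesz s (x, y)).
  apply: measurable_funTS.
  exact: (measurableT_comp (measurable_riesz s) (pair1_measurable x)).
apply: (@le_trans _ _ (\int[nu]_(x in E) (Cb%:E * (Ck%:E * M x + G x)))%E).
  (* Monotonicity is used in its measurability-free form: joint measurability of the mass
     [nu (eball x (edist x y))] is never established. *)
  apply: ge0_subset_le_integral => // [x Ex|x Ex].
    apply: integral_ge0 => y Ey.
    by rewrite mule_ge0 ?inve_ge0// lee_fin divr_ge0 ?powR_ge0.
  apply: (@le_trans _ _ (\int[nu]_(y in E)
      (Cb%:E * (M x * riesz s (x, y) + M y * riesz s (x, y))))%E).
    apply: ge0_subset_le_integral => // y Ey.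
      by rewrite mule_ge0 ?inve_ge0// lee_fin divr_ge0 ?powR_ge0.
    rewrite -ge0_muleDl// (muleC (M x + M y)%E); exact: besov_integrand_le.
  have mMK : measurable_fun E (fun y => M x * riesz s (x, y))%E.
    by apply: emeasurable_funM => //; exact: measurable_cst.
  have mKM2 : measurable_fun E (fun y => M y * riesz s (x, y))%E.
    apply: emeasurable_funM => //; exact: measurable_funTS.
  have MK0 y : E y -> (0 <= M x * riesz s (x, y))%E.
    by move=> _; rewrite mule_ge0// riesz_ge0.
  have MK0' y : E y -> (0 <= M y * riesz s (x, y))%E.
    by move=> _; exact: (KM0 (x, y)).
  rewrite ge0_integralZl//; [|exact: emeasurable_funD|by move=> y Ey; rewrite adde_ge0 ?MK0 ?MK0'|by rewrite lee_fin (ltW Cb0)].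
  apply: lee_wpmul2l; first by rewrite lee_fin (ltW Cb0).
  rewrite ge0_integralD// leeD2r//.
  rewrite ge0_integralZl//; last by move=> y _; exact: riesz_ge0.
  rewrite muleC lee_wpmul2r//.
  by under eq_integral do rewrite rieszC; exact: kernel.
have mE' (phi : 'rV[R]_n -> \bar R) : measurable_fun setT phi -> measurable_fun E phi.
  exact: measurable_funTS.
have mCM : measurable_fun E (fun x => Ck%:E * M x)%E.
  by apply: emeasurable_funM; [exact: measurable_cst|exact: mE'].
rewrite ge0_integralZl//; last 3 first.
- by apply: emeasurable_funD => //; exact: mE'.
- by move=> x _; rewrite adde_ge0// mule_ge0// lee_fin.
- by rewrite lee_fin (ltW Cb0).
rewrite ge0_integralD//; last 2 first.
- by move=> x _; rewrite mule_ge0// lee_fin.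
- exact: mE'.
rewrite ge0_integralZl//; last exact: mE'.
apply: (@le_trans _ _ (Cb%:E * (Ck%:E * \int[nu]_(x in E) M x +
   Ck%:E * \int[nu]_(x in E) M x))%E).
  by apply: lee_wpmul2l; [rewrite lee_fin (ltW Cb0)|rewrite leeD2l].
have I0 : (0 <= \int[nu]_(x in E) M x)%E by exact: integral_ge0.
have CbCk : (0 <= (Cb * Ck)%:E)%E by rewrite lee_fin mulr_ge0// ltW.
rewrite (_ : 2 * (Cb * Ck) = Cb * Ck + Cb * Ck); last by ring.
rewrite EFinD (ge0_muleDl _ CbCk CbCk) ge0_muleDr ?mule_ge0 ?lee_fin//.
by rewrite !muleA -!EFinM.
Qed.

End besov_bound.

(** * Boundedness and linearity of the trace *)

Section sobolev_trace.
Context {R : realType} {n : nat} (mu nu : {measure set 'rV[R]_n -> \bar R}).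
Variables (B E : set 'rV[R]_n) (p theta Q a s c Cu CP cnu Ck : R).
Hypotheses (mB : measurable B) (Boo : (mu B < +oo)%E).
Hypotheses (mE : measurable E) (Eoo : (nu E < +oo)%E).
Hypotheses (p1 : 1 < p) (theta0 : 0 <= theta) (Q0 : 0 <= Q).
Hypotheses (c0 : 0 < c) (Cu0 : 0 < Cu) (CP0 : 0 < CP) (cnu0 : 0 < cnu).
Hypothesis Ck0 : 0 <= Ck.
Hypothesis lower : forall x k, E x ->
  ((c * dyadic k `^ a)%:E <= mu (trace_ball B x k))%E.
Hypothesis upper : forall x k, E x ->
  (mu (trace_ball B x k) <= (Cu * dyadic k `^ a)%:E)%E.
Hypothesis E1 : forall x y, E x -> E y -> edist x y <= 1.
Hypothesis nu_lower : forall x y, E x -> E y -> x != y ->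
  ((cnu * edist x y `^ Q)%:E <= nu (eball x (edist x y)))%E.
Hypothesis kernel : forall y, (\int[nu]_(x in E) riesz s (x, y) <= Ck%:E)%E.
Hypothesis poincare : forall f g, sobolev_gradient mu p B f g ->
  forall x k, E x -> let D := trace_ball B x k in
  average mu D (fun z => `|f z - average mu D f|) <=
  CP * dyadic k * average mu D (fun z => enorm (g z) `^ p) `^ p^-1.
Hypotheses (t0 : 0 < 1 + (s - a) / p).
Hypothesis es : (1 + (s - a) / p) * p - theta * p - Q = - s.

Let p0 : 0 < p. Proof. exact: lt_trans p1. Qed.

(** The extension by zero lies in [Lfun] and is therefore measurable on the whole space, while [g]
    is controlled only on [B]. *)
Let h g z : R := `|((@enorm R n \o g) \_ B) z| `^ p.

Let h0 g z : 0 <= h g z. Proof. exact: powR_ge0. Qed.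

Let hE g z : B z -> h g z = enorm (g z) `^ p.
Proof. by move=> Bz; rewrite /h patchE mem_set//= ger0_norm// enorm_ge0. Qed.

Let t := 1 + (s - a) / p.
(** These constants repeat those local to the earlier sections. They are fixed before [f] and [g],
    which is what boundedness of the trace requires. *)
Let C1 := Cu / (c * 2^-1 `^ a) * (CP * c `^ (- p^-1)).
Let C2 := C1 / (1 - 2^-1 `^ t).

Let C10 : 0 < C1.
Proof.
by rewrite /C1 !mulr_gt0 ?invr_gt0 ?powR_gt0 ?mulr_gt0 ?powR_gt0 ?invr_gt0.
Qed.

Let C20 : 0 < C2.
Proof. by case/andP: (half_powR t0) => _ q1; rewrite divr_gt0// subr_gt0. Qed.

Let Cd := (2 * (C1 + C2)) `^ p.

Let Cd0 : 0 < Cd. Proof. by rewrite powR_gt0 ?mulr_gt0 ?addr_gt0. Qed.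

Let Cb := Cd / cnu * 4 `^ (theta * p + Q).

Let C3 := (2 * (C2 * dyadic 0 `^ t)) `^ p.
Let C4 := (2 * (c * dyadic 0 `^ a)^-1) `^ p.
(** Integration of [trace_size] over [E]: the [M] term yields [Ck], and the constant term yields
    [nu E] and the Hölder factor of the L^1 norm. *)
Let C5 := C3 * Ck + C4 * fine (mu B) `^ (1 - p^-1) `^ p * fine (nu E).

Section gradient.
Variables (f : 'rV[R]_n -> R) (g : 'rV[R]_n -> 'rV[R]_n).
Hypothesis fg : sobolev_gradient mu p B f g.

Let F := fine 'N[mu]_p%:E[EFin \o (f \_ B)]%E.
Let G := fine 'N[mu]_p%:E[EFin \o ((@enorm R n \o g) \_ B)]%E.

Let fLp : f \_ B \in Lfun mu p%:E. Proof. by case: fg. Qed.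
Let gLp : (@enorm R n \o g) \_ B \in Lfun mu p%:E. Proof. by case: fg. Qed.

Let F0 : 0 <= F. Proof. by rewrite fine_ge0// Lnorm_ge0. Qed.
Let G0 : 0 <= G. Proof. by rewrite fine_ge0// Lnorm_ge0. Qed.

Let mh : measurable_fun setT (h g).
Proof.
have /andP[/[!inE]/= mg _] := gLp.
apply: (measurableT_comp (measurable_powR p)).
exact: measurableT_comp.
Qed.

Let integral_h : (\int[mu]_(z in B) (h g z)%:E <= (G `^ p)%:E)%E.
Proof.
rewrite -poweR_EFin fineK; last exact: Lfun_norm_fin.
rewrite powR_Lnorm ?gt_eqF//.
rewrite (eq_integral (fun z => (h g z)%:E)) => [|z _ //].
apply: ge0_subset_integral => //; first exact/measurable_EFinP.
by move=> z _; rewrite lee_fin.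
Qed.

Let hB : mu.-integrable B (EFin \o h g).
Proof.
apply/integrableP; split; first by apply/measurable_EFinP; exact: measurable_funTS.
under eq_integral do rewrite /= ger0_norm//.
by apply: le_lt_trans integral_h _; rewrite ltry.
Qed.

Lemma sobolev_integrable : mu.-integrable B (EFin \o f).
Proof. exact: Lfun_integrable_in fLp. Qed.

Let poincare_h x k : E x -> let D := trace_ball B x k in
  average mu D (fun z => `|f z - average mu D f|) <=
  CP * dyadic k * average mu D (h g) `^ p^-1.
Proof.
move=> Ex /=; apply: le_trans (poincare fg k Ex) _.
rewrite le_eqVlt; apply/orP; left; apply/eqP; congr (_ * (_ * _) `^ _).
by apply: eq_Rintegral => z /set_mem[_ Bz]; rewrite hE.
Qed.

Local Notation M := (potential mu B s (h g)).

Let M0 x : (0 <= M x)%E.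
Proof. by apply: integral_ge0 => z _; rewrite mule_ge0 ?riesz_ge0// lee_fin. Qed.

Let mM : measurable_fun setT M. Proof. exact: measurable_potential. Qed.

Let integral_M : (\int[nu]_(x in E) M x <= (Ck * G `^ p)%:E)%E.
Proof.
apply: (@le_trans _ _ (Ck%:E * \int[mu]_(z in B) (h g z)%:E)%E).
  apply: (integral_kernel_le mE mB Eoo Boo) => //.
  - by move=> z; exact: riesz_ge0.
  - exact: measurable_riesz.
  - by move=> z; rewrite lee_fin.
  - exact/measurable_EFinP.
by rewrite EFinM lee_wpmul2l// lee_fin.
Qed.

(** [M] has a finite integral over [E], hence is finite almost everywhere there, and [trace_rate]
    applies at such points. *)
Lemma sobolev_trace_cvg : {ae nu, forall x, E x ->
  average mu (trace_ball B x k) f @[k --> \oo] --> trace mu B f x}.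
Proof.
have iM : nu.-integrable E M.
  apply/integrableP; split; first exact: measurable_funTS.
  under eq_integral do rewrite gee0_abs//.
  by apply: le_lt_trans integral_M _; rewrite ltry.
apply: filterS (integrable_ae mE iM) => x Mx Ex.
have Mf := esym (fineK (Mx Ex)).
have [] := @trace_rate R n mu B E p a s c Cu CP f (h g) mB Boo p1 c0 Cu0 CP0
  lower upper sobolev_integrable (@h0 g) mh hB poincare_h t0 x _ Ex Mf.
by [].
Qed.

Let sobolev_trace_energy :
  (besov_energy nu E theta p (trace mu B f) <=
   (2 * (Cb * Ck) * Ck * (F + G) `^ p)%:E)%E.
Proof.
apply: le_trans (@besov_energy_le R n nu E (trace mu B f) M p theta Q s (t * p)
  Cd cnu Ck mE Eoo p0 Cd0 cnu0 E1 nu_lower theta0 Q0 es M0 mM _ kernel) _.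
  move=> x y k mx my Ex Ey Mx My xy.
  exact: (@trace_difference R n mu B E p a s c Cu CP f (h g) mB Boo p1 c0 Cu0 CP0
    lower upper sobolev_integrable (@h0 g) mh hB poincare_h t0).
have K0 : 0 <= 2 * (Cb * Ck).
  by rewrite !mulr_ge0 ?powR_ge0 ?invr_ge0// ltW.
apply: (@le_trans _ _ ((2 * (Cb * Ck))%:E * (Ck * G `^ p)%:E)%E).
  by rewrite lee_wpmul2l ?lee_fin.
rewrite -EFinM lee_fin -!mulrA.
rewrite !ler_wpM2l// ?mulr_ge0 ?powR_ge0 ?invr_ge0 ?(ltW cnu0)//.
by apply: ge0_ler_powR; rewrite ?nnegrE ?addr_ge0 ?lerDr// ltW.
Qed.

Let sobolev_trace_Lp :
  (\int[nu]_(x in E) (`|trace mu B f x| `^ p)%:E <=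
   (C5 * (F + G) `^ p)%:E)%E.
Proof.
pose I := \int[mu]_(z in B) `|f z|.
have I0 : 0 <= I by apply: Rintegral_ge0.
have IF : I <= F * fine (mu B) `^ (1 - p^-1).
  have fi : (\int[mu]_(z in B) `|f z|%:E)%E \is a fin_num.
    by have := integrable_fin_num mB (integrable_norm sobolev_integrable).
  rewrite -lee_fin fineK// EFinM fineK; last exact: Lfun_norm_fin.
  exact: Lfun_integral_le.
have C30 : 0 < C3 by rewrite powR_gt0// mulr_gt0// (mulr_gt0 C20)// powR_gt0// dyadic_gt0.
have C40 : 0 <= C4 by exact: powR_ge0.
apply: (@le_trans _ _ (\int[nu]_(x in E) (C3%:E * M x + (C4 * I `^ p)%:E))%E).
  apply: ge0_subset_le_integral => // x Ex.
  have [Moo|] := eqVneq (M x) +oo%E.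
    by rewrite Moo gt0_muley ?lte_fin// addye// leey.
  rewrite -ltey -ge0_fin_numE// => Mf.
  rewrite -(fineK Mf) -EFinM -EFinD lee_fin.
  apply: (@trace_size R n mu B E p a s c Cu CP f (h g) mB Boo p1 c0 Cu0 CP0
    lower upper sobolev_integrable (@h0 g) mh hB poincare_h t0) => //.
  by rewrite fineK.
have mME : measurable_fun E M by exact: measurable_funTS.
have mCM : measurable_fun E (fun x => C3%:E * M x)%E.
  by apply: emeasurable_funM => //; exact: measurable_cst.
have CM0 x : E x -> (0 <= C3%:E * M x)%E.
  by move=> _; rewrite mule_ge0// lee_fin ltW.
have CI0 x : E x -> (0 <= (C4 * I `^ p)%:E)%E.
  by move=> _; rewrite lee_fin (mulr_ge0 C40) ?powR_ge0.
have mcst : measurable_fun E (fun=> (C4 * I `^ p)%:E) by exact: measurable_cst.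
rewrite ge0_integralD// ge0_integralZl ?lee_fin ?(ltW C30)//.
rewrite integral_cst// -(@fineK _ (nu E)) ?ge0_fin_numE//.
apply: (@le_trans _ _ (C3%:E * (Ck * G `^ p)%:E +
    (C4 * I `^ p)%:E * (fine (nu E))%:E)%E).
  by apply: leeD => //; apply: lee_wpmul2l => //; rewrite lee_fin ltW.
rewrite -!EFinM -EFinD lee_fin mulrDl.
have GFG : G `^ p <= (F + G) `^ p.
  by apply: ge0_ler_powR; rewrite ?nnegrE ?addr_ge0 ?lerDr// ltW.
have FFG : F `^ p <= (F + G) `^ p.
  by apply: ge0_ler_powR; rewrite ?nnegrE ?addr_ge0 ?lerDl// ltW.
have IFG : I `^ p <= fine (mu B) `^ (1 - p^-1) `^ p * (F + G) `^ p.
  apply: (@le_trans _ _ ((F * fine (mu B) `^ (1 - p^-1)) `^ p)).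
    by apply: ge0_ler_powR; rewrite ?nnegrE ?mulr_ge0 ?powR_ge0// ltW.
  by rewrite powRM ?powR_ge0// mulrC ler_wpM2l ?powR_ge0.
apply: lerD.
  by rewrite -mulrA ler_wpM2l ?(ltW C30)// ler_wpM2l.
rewrite [leRHS]mulrAC ler_wpM2r ?fine_ge0// -mulrA.
by rewrite ler_wpM2l.
Qed.

Let norm_sum : (F + G)%:E = sobolev_norm mu p B f g.
Proof. by rewrite EFinD /F /G !fineK//; exact: Lfun_norm_fin. Qed.

Let root_le (X : \bar R) (L : R) : 0 <= L -> (0 <= X)%E ->
  (X <= (L * (F + G) `^ p)%:E)%E ->
  (X `^ p^-1 <= (L `^ p^-1 * (F + G))%:E)%E.
Proof.
move=> L0 X0 XL; have FG0 : 0 <= F + G by rewrite addr_ge0.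
have LFG : (0 <= (L * (F + G) `^ p)%:E)%E by rewrite lee_fin mulr_ge0 ?powR_ge0.
apply: le_trans (gt0_ler_poweR _ _ _ XL) _.
- by rewrite invr_ge0 ltW.
- by rewrite in_itv/= X0 leey.
- by rewrite in_itv/= LFG leey.
rewrite poweR_EFin (powRM _ L0 (powR_ge0 _ _)) -powRrM mulfV ?gt_eqF//.
by rewrite powRr1.
Qed.

Lemma sobolev_trace_besov : besov nu E theta p (trace mu B f) /\
  (besov_norm nu E theta p (trace mu B f) <=
   (C5 `^ p^-1 + (2 * (Cb * Ck) * Ck) `^ p^-1)%:E * sobolev_norm mu p B f g)%E.
Proof.
have mf := Lfun_measurable_in mB fLp.
have C50 : 0 <= C5.
  apply: addr_ge0; apply: mulr_ge0 => //; rewrite ?powR_ge0 ?fine_ge0//.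
  by rewrite mulr_ge0 ?powR_ge0.
have C60 : 0 <= 2 * (Cb * Ck) * Ck.
  apply: mulr_ge0 => //; apply: mulr_ge0 => //; apply: mulr_ge0 => //.
  by rewrite /Cb !mulr_ge0 ?powR_ge0 ?invr_ge0// ltW.
have en0 : (0 <= besov_energy nu E theta p (trace mu B f))%E.
  apply: integral_ge0 => x Ex; apply: integral_ge0 => y Ey.
  by rewrite mule_ge0 ?inve_ge0// lee_fin divr_ge0 ?powR_ge0.
have NE := Lnorm_patch nu E (trace mu B f) p0.
have Lp := root_le C50 _ sobolev_trace_Lp.
split; last first.
  rewrite -norm_sum -EFinM mulrDl EFinD /besov_norm NE; apply: leeD.
    by apply: Lp; apply: integral_ge0 => x _; rewrite lee_fin powR_ge0.
  exact: root_le.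
split; last by apply: le_lt_trans sobolev_trace_energy _; rewrite ltry.
apply/andP; split; rewrite inE/=.
  apply/(measurable_restrict _ mE measurableT); rewrite setTI.
  by apply: measurable_funTS; exact: measurable_trace.
rewrite /finite_norm NE; apply: le_lt_trans (Lp _) _; last by rewrite ltry.
by apply: integral_ge0 => x _; rewrite lee_fin powR_ge0.
Qed.

End gradient.

Lemma trace_bounded_linear :
  bounded_linear_operator mu p B nu E theta (trace mu B).
Proof.
split.
- by move=> f [g fg]; have [] := sobolev_trace_besov fg.
(* Averages see only [mu]-classes, so the two traces agree at every point. *)
- move=> f1 f2 [g1 fg1] [g2 fg2] f12; apply: aeW => x Ex.
  congr fine; congr limn_esup; apply/funext => k; congr (_%:E).
  rewrite /average; congr (_ * fine _).
  have mD := measurable_trace_ball x k mB.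
  have DB : trace_ball B x k `<=` B by exact: subIsetr.
  apply: ae_eq_integral => //.
  + by have /integrableP[] := integrableS mB mD DB (sobolev_integrable fg1).
  + by have /integrableP[] := integrableS mB mD DB (sobolev_integrable fg2).
  + by apply: filterS f12 => z f12z /DB Bz /=; rewrite f12z.
(* A limit superior is not additive; linearity holds where the averages of both functions
   converge. *)
- move=> b f1 f2 [g1 fg1] [g2 fg2].
  apply: filterS2 (sobolev_trace_cvg fg1) (sobolev_trace_cvg fg2).
  move=> x cvg1 cvg2 Ex; apply: trace_cvg.
  have lim12 := cvgD (cvgM (cvg_cst b) (cvg1 Ex)) (cvg2 Ex).
  rewrite (_ : (fun k => average mu (trace_ball B x k) _) = (fun k =>
    b * average mu (trace_ball B x k) f1 + average mu (trace_ball B x k) f2)).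
    exact: lim12.
  apply/funext => k.
  have mD := measurable_trace_ball x k mB.
  have DB : trace_ball B x k `<=` B by exact: subIsetr.
  have i1 := integrableS mB mD DB (sobolev_integrable fg1).
  have i2 := integrableS mB mD DB (sobolev_integrable fg2).
  rewrite /average RintegralD ?RintegralZl// ?mulrDr ?(mulrCA b)//.
  exact: (integrableZl mD b i1).
- exists (C5 `^ p^-1 + (2 * (Cb * Ck) * Ck) `^ p^-1) => f g fg.
  by have [] := sobolev_trace_besov fg.
Qed.

End sobolev_trace.

(** * Lipschitz functions and the main theorem *)

Section lipschitz_trace.
Context {R : realType} {n : nat} (mu : {measure set 'rV[R]_n -> \bar R}).
Implicit Types (B : set 'rV[R]_n) (u : 'rV[R]_n -> R).

Lemma lipschitz_rV_ge0 B u : lipschitz_rV B u -> exists2 L : R, 0 <= L &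
  forall x y, B x -> B y -> `|u x - u y| <= L * edist x y.
Proof.
move=> [L uL]; exists `|L| => // x y Bx By.
by apply: le_trans (uL x y Bx By) _; rewrite ler_wpM2r ?Defs.edist_ge0 ?ler_norm.
Qed.

Lemma lipschitz_rV_measurable B u : open B -> lipschitz_rV B u ->
  measurable_fun B u.
Proof.
move=> oB /lipschitz_rV_ge0[L L0 uL].
have L10 : 0 < L + 1 by rewrite ltr_wpDl.
apply: (measurability _ (RGenOInfty.measurableE R)) => _ [_ [b ->] <-].
apply: measurable_open_rV; rewrite openE => x [Bx]; rewrite /= in_itv/= andbT => bx.
(* Adding 1 avoids a zero denominator when [L = 0]. *)
pose r := (u x - b) / (L + 1).
have r0 : 0 < r by rewrite divr_gt0// subr_gt0.
have nB : nbhs x B by exact: open_nbhs_nbhs.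
have nr : nbhs x (eball x r).
  by apply: open_nbhs_nbhs; split; [exact: eball_open|exact: eball_center].
apply: filterS (filterI nB nr) => y [By xy]; split=> //=; rewrite in_itv/= andbT.
have := le_trans (ler_norm _) (uL x y Bx By); move: xy; rewrite /eball/= ltr_pdivlMr//.
have := Defs.edist_ge0 x y; move: (edist x y) => d d0; nra.
Qed.

Lemma lipschitz_average_cvg B u x : open B -> measurable B ->
  (mu B < +oo)%E -> lipschitz_rV B u -> B x ->
  (forall k, 0 < mu (trace_ball B x k))%E ->
  average mu (trace_ball B x k) u @[k --> \oo] --> u x.
Proof.
move=> oB mB Boo uB Bx mupos.
have mu_B := lipschitz_rV_measurable oB uB.
have [L L0 uL] := lipschitz_rV_ge0 uB.
have average_dist k : `|u x - average mu (trace_ball B x k) u| <= L * dyadic k.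
  set D := trace_ball B x k.
  have mD : measurable D by exact: measurable_trace_ball.
  have DB : D `<=` B by exact: subIsetr.
  have Doo : (mu D < +oo)%E.
    by apply: le_lt_trans Boo; apply: le_measure; rewrite ?inE.
  have m0 : 0 < fine (mu D) by rewrite fine_gt0// mupos.
  have icst (b : R) : mu.-integrable D (EFin \o cst b).
    apply/integrableP; split.
      by apply/measurable_EFinP; exact: measurable_cst.
    by rewrite (integral_cst mu mD `|b|%:E) lte_mul_pinfty.
  have uD z : D z -> `|u x - u z| <= L * dyadic k.
    move=> [/= xz Bz]; apply: le_trans (uL _ _ Bx Bz) _.
    by rewrite ler_wpM2l// ltW.
  have iu : mu.-integrable D (EFin \o u).
    apply: (le_integrable mD _ _ (icst (`|u x| + L * dyadic k))).
      by apply/measurable_EFinP; exact: measurable_funS mu_B.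
    move=> z Dz; rewrite lee_fin [leRHS]ger0_norm; last first.
      by rewrite addr_ge0// mulr_ge0// ltW// dyadic_gt0.
    rewrite -[u z](subKr (u x)); apply: le_trans (ler_normB _ _) _.
    by rewrite lerD2l uD.
  have -> : u x - average mu D u =
      (fine (mu D))^-1 * \int[mu]_(z in D) (u x - u z).
    rewrite RintegralB//; last exact: icst.
    by rewrite Rintegral_cst// mulrBr mulrCA mulVf ?gt_eqF// mulr1.
  rewrite normrM gtr0_norm ?invr_gt0// mulrC ler_pdivrMr//.
  have id : mu.-integrable D (EFin \o (fun z => u x - u z)).
    exact: (integrableB mD (icst (u x)) iu).
  apply: le_trans (le_normr_Rintegral mD id) _.
  rewrite -(Rintegral_cst mu mD); apply: le_Rintegral => //.
  - exact: integrable_norm id.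
  - exact: icst.
apply/cvgrPdist_le => e e0.
have lim0 : L * dyadic k @[k --> \oo] --> (0 : R).
  by have := cvgM (cvg_cst L) (@dyadic_cvg0 R); rewrite mulr0; exact.
by apply: filterS (cvgr_le 0 lim0 e e0) => k /= ke; exact: le_trans (average_dist k) ke.
Qed.

End lipschitz_trace.

(** The ball lies in a cube, compact as a product of segments, over which the locally integrable
    weight has a finite integral. *)
Lemma weighted_measure_bounded (R : realType) n
    (mu : {measure set 'rV[R]_n -> \bar R}) c rho :
  weighted_measure mu -> (mu (eball c rho) < +oo)%E.
Proof.
move=> [w [w0 [mw wK] muw]].
pose K := [set v : 'rV[R]_n |
  forall i, `[c ord0 i - rho, c ord0 i + rho]%classic (v ord0 i)].
have cK : compact K.
  apply: (@rV_compact R n (fun i => `[c ord0 i - rho, c ord0 i + rho]%classic)).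
  by move=> i; exact: segment_compact.
have BK : eball c rho `<=` K.
  move=> v /= cv i /=; rewrite in_itv/=.
  have := le_lt_trans (ler_coord_edist c v i) cv.
  by rewrite ltr_norml => /andP[h1 h2]; apply/andP; split; lra.
have mK := compact_measurable_rV cK.
apply: (@le_lt_trans _ _ (mu K)).
  by apply: le_measure; rewrite ?inE//; exact: measurable_eball.
rewrite muw//; have := wK K (@subsetT _ _) cK.
by under eq_integral do rewrite ger0_norm//.
Qed.

Theorem theorem1p1 (R : realType) (n : nat) (Q : R) (E : set 'rV[R]_n)
    (c : 'rV[R]_n) (rho p theta alpha : R)
    (mu : {measure set 'rV[R]_n -> \bar R}) (cE : compact E) :
  let B := eball c rho in
  let nu : {measure set 'rV[R]_n -> \bar R} :=
    mrestr (hausdorff_measure Q) (compact_measurable_rV cE) in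
  0 < Q < n%:R ->
  ahlfors_regular Q E ->
  (ediam E <= 1)%E ->
  0 < rho ->
  E `<=` eball c (rho / 2) ->
  1 < p ->
  0 < theta < 1 ->
  p * theta < 1 ->
  alpha <= 0 ->
  0 < alpha + n%:R - Q ->
  theta < 1 - (alpha + n%:R - Q) / p ->
  weighted_measure mu ->
  (exists2 C : R, 1 <= C & forall x r, E x -> 0 < r <= 10 ->
    ((C^-1 * r `^ (n%:R + alpha))%:E <= mu (eball x r)
       <= (C * r `^ (n%:R + alpha))%:E)%E) ->
  doubling_on mu B ->
  poincare_on mu p B ->
  exists T : ('rV[R]_n -> R) -> ('rV[R]_n -> R),
    bounded_linear_operator mu p B nu E theta T /\
    forall u, lipschitz_rV B u -> {ae nu, forall x, E x -> T u x = u x}.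
Proof.
move=> B nu /andP[Q0 Qn] aE E1 rho0 EB p1 /andP[theta0 theta1] pt1 alpha0.
move=> codim0 theta_lt wmu [C C1 muC] _ [CP CP1 PI].
have C0 : 0 < C by exact: lt_le_trans C1.
have p0 : 0 < p by exact: lt_trans p1.
pose a := n%:R + alpha.
have a0 : 0 < a by rewrite /a; lra.
pose eta := (p * (1 - theta) - (a - Q)) / 2.
have eta0 : 0 < eta.
  rewrite /eta divr_gt0// subr_gt0; move: theta_lt.
  rewrite ltrBrDl -ltrBrDr ltr_pdivrMr// mulrC /a; lra.
pose s := Q - eta.
have tp : (1 + (s - a) / p) * p = theta * p + eta.
  by rewrite mulrDl divfK ?gt_eqF// /s /eta; field.
have t0 : 0 < 1 + (s - a) / p.
  by rewrite -(pmulr_lgt0 _ p0) tp addr_gt0// mulr_gt0.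
have es : (1 + (s - a) / p) * p - theta * p - Q = - s.
  by rewrite tp /s; ring.
have mB : measurable B by exact: measurable_eball.
have Boo : (mu B < +oo)%E by exact: weighted_measure_bounded.
have mE := compact_measurable_rV cE.
have nuE A : nu A = hausdorff_measure Q (A `&` E) by [].
have EsubB x : E x -> B x.
  by move=> /EB; apply: eball_le; rewrite ler_pdivrMr// ler_pMr// ler1n.
have [Cnu Cnu0 nu_upper] := ahlfors_regular_upper cE Q0 aE E1.
have Eoo : (nu E < +oo)%E.
  have [->|/set0P[x Ex]] := eqVneq E set0; first by rewrite nuE set0I measure0 ltry.
  have E2 : E `<=` eball x 2.
    move=> y Ey; have := le_trans (edist_le_ediam Ex Ey) E1.
    by rewrite lee_fin /eball/= => /le_lt_trans; apply; rewrite ltr1n.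
  by rewrite nuE setIid -(setIidl E2); apply: le_lt_trans (nu_upper x 2 _) _ => //;
    rewrite ltry.
have [Ck Ck0 kernel] : exists2 Ck : R, 0 <= Ck &
    forall y, (\int[nu]_(x in E) riesz s (x, y) <= Ck%:E)%E.
  apply: (@integral_riesz_le R n nu E Q s Cnu mE) => //.
  - by rewrite /s gtrBl.
  - exact: ltW.
  - by move=> y r r0; rewrite nuE -setIA (setIC (eball y r)) setIA setIid; exact: nu_upper.
have dle1 x y : E x -> E y -> edist x y <= 1.
  by move=> Ex Ey; rewrite -lee_fin; exact: le_trans (edist_le_ediam Ex Ey) E1.
have [cnu cnu0 nu_lower] : exists2 cnu : R, 0 < cnu &
    forall x y, E x -> E y -> x != y ->
    ((cnu * edist x y `^ Q)%:E <= nu (eball x (edist x y)))%E.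
  have [C' C'1 HC] := aE; exists C'^-1 => [|x y Ex Ey xy].
    by rewrite invr_gt0; exact: lt_le_trans C'1.
  (* The radius [edist x y] is admissible in the regularity condition because it is at most the
     diameter of [E]. *)
  have /andP[+ _] := HC x (edist x y) Ex (edist_gt0 xy) (edist_le_ediam Ex Ey).
  by rewrite nuE setIC.
(* Dyadic radii are at most 2, so [c0 * dyadic k <= rho / 2] and the shrunken ball about a point of
   the half ball stays inside [B]; [c0 <= 1] keeps it inside [eball x (dyadic k)]. *)
pose c0 := Num.min 1 (rho / 4).
have c00 : 0 < c0 by rewrite lt_min ltr01 divr_gt0.
have upper x k : E x -> (mu (trace_ball B x k) <= (C * dyadic k `^ a)%:E)%E.
  move=> Ex; have r10 : 0 < (dyadic k : R) <= 10.
    rewrite dyadic_gt0/=; apply: le_trans (dyadic_le2 k) _; by rewrite ler_nat.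
  have /andP[_] := muC x (dyadic k) Ex r10; apply: le_trans.
  apply: le_measure; rewrite ?inE//; [|exact: measurable_eball|].
    exact: measurable_trace_ball.
  exact: subIsetl.
have lower x k : E x ->
    ((C^-1 * c0 `^ a * dyadic k `^ a)%:E <= mu (trace_ball B x k))%E.
  move=> Ex; have dk0 : 0 < (dyadic k : R) by exact: dyadic_gt0.
  have dk2 : (dyadic k : R) <= 2 by exact: dyadic_le2.
  have r0 : 0 < c0 * dyadic k by rewrite mulr_gt0.
  have c01 : c0 <= 1 by rewrite ge_min lexx.
  have c0rho : c0 <= rho / 4 by rewrite ge_min lexx orbT.
  have r10 : c0 * dyadic k <= 10.
    apply: le_trans (ler_pM (ltW c00) (ltW dk0) c01 dk2) _.
    by rewrite mul1r ler_nat.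
  have := muC x (c0 * dyadic k) Ex; rewrite r0 r10 => /(_ isT)/andP[+ _].
  rewrite -/a (powRM a (ltW c00) (ltW dk0)) mulrA => /le_trans; apply.
  apply: le_measure; rewrite ?inE//; [exact: measurable_eball|exact: measurable_trace_ball|].
  move=> z xz; split; first by apply: eball_le xz; rewrite ler_piMl// ltW.
  move: xz; apply: eball_sub.
  have /ltW := EB x Ex; rewrite -/(edist c x) => cx.
  have := ler_pM (ltW c00) (ltW dk0) c0rho dk2; lra.
have muD0 x k : E x -> (0 < mu (trace_ball B x k))%E.
  move=> Ex; apply: lt_le_trans (lower x k Ex).
  by rewrite lte_fin !mulr_gt0 ?powR_gt0 ?invr_gt0// dyadic_gt0.
have PIE f g : sobolev_gradient mu p B f g ->
    forall x k, E x -> let D := trace_ball B x k in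
    average mu D (fun z => `|f z - average mu D f|) <=
    CP * dyadic k * average mu D (fun z => enorm (g z) `^ p) `^ p^-1.
  move=> fg x k Ex; apply: PI => //.
    by rewrite dyadic_gt0/=; apply: le_trans (dyadic_le2 k) _; rewrite ler_nat.
  by exists x; split; [exact/eball_center/dyadic_gt0|exact: EsubB].
exists (trace mu B); split.
  apply: (@trace_bounded_linear R n mu nu B E p theta Q a s (C^-1 * c0 `^ a) C CP
    cnu Ck mB Boo mE Eoo p1 (ltW theta0) (ltW Q0)) => //.
  - by rewrite mulr_gt0 ?powR_gt0 ?invr_gt0.
  - exact: lt_trans CP1.
move=> u uB; apply: aeW => x Ex; apply: trace_cvg.
apply: lipschitz_average_cvg => //; first exact: eball_open.
  exact: EsubB.
by move=> k; exact: muD0.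
Qed.
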